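(* Let $\mathfrak g$ be a real semi-simple Lie algebra and let $(\mu,\phi)\in L_n(\mathfrak g)$ be a critical pair. Then there exists an (orthogonal) decomposition $$\mathfrak h_\mu=\mathfrak m_\mu\oplus\mathfrak a_\mu\oplus\mathfrak n_\mu,$$ where $\mathfrak m_\mu$ is a Levi factor, $\mathfrak a_\mu\oplus\mathfrak n_\mu$ is the radical and $\mathfrak n_\mu$ is the nilradical of $\mathfrak h_\mu$. Furthermore, the restriction $(\nu,\psi)$ of $(\mu,\phi)$ to $\mathfrak n_\mu$ (so $\nu$ is the bracket of $\mathfrak n_\mu$ and $\psi=\phi|_{\mathfrak n_\mu}$) is a critical pair with $u_{\nu,\psi}=u_{\mu,\phi}$ and with $D_{\nu,\psi}$ equal to the restriction of $D_{\mu,\phi}$ to $\mathfrak n_\mu$.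
   Context: Notation. $V_n(\mathfrak g)=\mathrm{Lin}(\Lambda^2\mathbb R^n,\mathbb R^n)\oplus \mathrm{Lin}(\mathbb R^n,\mathfrak g)$. $L_n(\mathfrak g)\subseteq V_n(\mathfrak g)$ is the set of pairs $(\mu,\phi)$ such that $\mu$ is a Lie bracket on $\mathbb R^n$ and $\phi:\mathfrak h_\mu=(\mathbb R^n,\mu)\to\mathfrak g$ is a Lie algebra homomorphism. The Lie algebra $\mathfrak{gc}_n(\mathfrak g)=\mathfrak{gl}(n,\mathbb R)\oplus\mathfrak g$ acts on $V_n(\mathfrak g)$ by $(A,v)\cdot(\mu,\phi)=(A\cdot\mu,\ \mathrm{ad}_v\phi-\phi A)$ with $(A\cdot\mu)(X,Y)=A\mu(X,Y)-\mu(AX,Y)-\mu(X,AY)$. For $(\mu,\phi)\in L_n(\mathfrak g)$ put $\mathrm{der}(\mu,\phi)=\{(\delta,v)\in\mathfrak{gc}_n(\mathfrak g): (\delta,v)\cdot(\mu,\phi)=0\}$, i.e. $\delta$ is a derivation of $\mathfrak h_\mu$ and $\mathrm{ad}_v\phi=\phi\delta$. Fix an inner product on $\mathbb R^n$ and a Cartan involution $\theta$ of $\mathfrak g$; with $B_{\mathfrak g}$ the Killing form, put $\langle X,Y\rangle=-B_{\mathfrak g}(\theta X,Y)$ on $\mathfrak g$. The induced inner products are: on $V_n(\mathfrak g)$, the one with $\|(\mu,\phi)\|^2=\sum_{i<j}\|\mu(e_i,e_j)\|^2+\sum_i\|\phi(e_i)\|^2$ for any orthonormal basis $(e_i)$ of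 $\mathbb R^n$; on $\mathfrak{gc}_n(\mathfrak g)$, $\langle (A,v),(B,w)\rangle=\mathrm{Tr}(AB^* )-B_{\mathfrak g}(\theta v,w)$. Define $M(\mu,\phi)\in\mathfrak{gc}_n(\mathfrak g)$ by $\langle M(\mu,\phi),(A,v)\rangle=\langle (A,v)\cdot(\mu,\phi),(\mu,\phi)\rangle$ for all $(A,v)$. Put $k_{\mu,\phi}=\|M(\mu,\phi)\|^2/\|(\mu,\phi)\|^2$ and $(D_{\mu,\phi},u_{\mu,\phi})=M(\mu,\phi)+k_{\mu,\phi}(\mathrm{id},0)\in\mathfrak{gl}(n,\mathbb R)\oplus\mathfrak g$. A pair $(\mu,\phi)$ in $L_n(\mathfrak g)$ is called critical if its projectivization $(\mu:\phi)$, in $(L_n(\mathfrak g)\smallsetminus\{(0,0)\})/\mathbb R^\times$, is a critical point of the energy $E(\mu:\phi)=\|M(\mu,\phi)\|^2/\|(\mu,\phi)\|^4$; equivalently, $(D_{\mu,\phi},u_{\mu,\phi})\in\mathrm{der}(\mu,\phi)$. For the restriction to $\mathfrak n_\mu$ the same definitions are used with $\mathbb R^n$ replaced by $\mathfrak n_\mu$ equipped with the restricted inner product (and the same $\mathfrak g,\theta$).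
   Formalization: That the restriction (ν,ψ) to the nilradical is critical with D_{ν,ψ} the restriction of D_{μ,φ} is claimed only when (ν,ψ)≠(0,0); for (0,0) (e.g. [e1,e2]=e2, φ=0) there is no projectivization and k_{ν,ψ}=0/0 is undefined. *)

(* Defs.v *)
From HB Require Import structures.
From mathcomp Require Import all_boot all_order all_algebra.
From mathcomp Require Import sesquilinear.
From mathcomp Require Import all_classical all_reals all_analysis.

Set Implicit Arguments.
Unset Strict Implicit.
Unset Printing Implicit Defensive.

Import Order.TTheory GRing.Theory Num.Theory.
Import numFieldNormedType.Exports.

Local Open Scope classical_set_scope.
Local Open Scope ring_scope.

Section LieAlgebras.
Variables (K : fieldType) (V : vectType K).
Implicit Types (br : 'Hom(V, 'End(V))) (H I J U W : {vspace V}).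

(* A bilinear operation on V is encoded as a linear map br : V -> End(V), so
   that br x y is the product of x and y, and br itself is the map ad. *)

Definition alternating br := forall x, br x x = 0.

Definition lie_bracket br :=
  alternating br /\
  forall x y z, br x (br y z) + br y (br z x) + br z (br x y) = 0.

Definition brv br U W : {vspace V} :=
  <<[seq br x y | x <- vbasis U, y <- vbasis W]>>%VS.

Definition subalgebra br H := {in H &, forall x y, br x y \in H}.

Definition ideal_in br H I :=
  (I <= H)%VS /\ {in H & I, forall x y, br x y \in I}.

Definition solvable_sub br I :=
  exists k, iter k (fun J => brv br J J) I = 0%VS.

Definition nilpotent_sub br I :=
  exists k, iter k (fun J => brv br I J) I = 0%VS.

(* Vanishing radical, for the subalgebra H. *)
Definition semisimple br H :=
  forall I, ideal_in br H I -> solvable_sub br I -> I = 0%VS.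

Definition is_radical br I :=
  [/\ ideal_in br fullv I, solvable_sub br I &
      forall J, ideal_in br fullv J -> solvable_sub br J -> (J <= I)%VS].

Definition is_nilradical br I :=
  [/\ ideal_in br fullv I, nilpotent_sub br I &
      forall J, ideal_in br fullv J -> nilpotent_sub br J -> (J <= I)%VS].

Definition levi_factor br H :=
  [/\ subalgebra br H, semisimple br H &
      exists2 I, is_radical br I & (H + I = fullv)%VS /\ (H :&: I = 0)%VS].

Definition lfun_tr (f : 'End(V)) : K := \tr (passmx.mxof (vbasis fullv) (vbasis fullv) f).

Definition killing br (x y : V) : K := lfun_tr (br x \o br y)%VF.

End LieAlgebras.

Definition cartan_involution (R : realFieldType) (g : vectType R)
    (ad : 'Hom(g, 'End(g))) (theta : 'End(g)) :=
  [/\ forall x, theta (theta x) = x,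
      forall x y, theta (ad x y) = ad (theta x) (theta y) &
      forall x, x != 0 -> 0 < - killing ad (theta x) x].

Section Pairs.
Variables (R : realType) (g V : vectType R).
Variables (ad : 'Hom(g, 'End(g))) (theta : 'End(g)).

(* Pairs (mu, phi), mu not necessarily alternating; the alternating ones,
   singled out by [in_Vn], form the space V_n(g). *)
Definition pairs : vectType R := ('Hom(V, 'End(V)) * 'Hom(V, g))%type.

Definition gc : vectType R := ('End(V) * g)%type.

Definition in_Vn (x : pairs) := alternating x.1.

Definition in_Ln (x : pairs) :=
  lie_bracket x.1 /\ forall X Y, x.2 (x.1 X Y) = ad (x.2 X) (x.2 Y).

Definition act_bracket (A : 'End(V)) (mu : 'Hom(V, 'End(V))) :
    'Hom(V, 'End(V)) :=
  linfun (fun X => (A \o mu X)%VF - mu (A X) - (mu X \o A)%VF).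

Definition act (a : gc) (x : pairs) : pairs :=
  (act_bracket a.1 x.1, (ad a.2 \o x.2)%VF - (x.2 \o a.1)%VF).

Lemma act_bracketE A mu X Y :
  act_bracket A mu X Y = A (mu X Y) - mu (A X) Y - mu X (A Y).
Proof.
rewrite /act_bracket; set f := (fun X => _).
have fE Z W : f Z W = A (mu Z W) - mu (A Z) W - mu Z (A W).
  by rewrite /f !(add_lfunE, opp_lfunE) !comp_lfunE.
have fl : linear f.
  clearbody f => c u v; apply/lfunP => w.
  have E (a b p q r s : V) :
      c *: a + b - (c *: p + q) - (c *: r + s) =
      c *: a + c *: - p + c *: - r + (b - q - s).
    by rewrite !scalerN !opprD (addrACA (c *: a)) [LHS]addrACA.
  rewrite add_lfunE /= scale_lfunE !fE !linearD !linearZ /=.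
  rewrite !add_lfunE /= !scale_lfunE linearD linearZ /=.
  exact: E.
pose fL := GRing.isLinear.Build _ _ _ _ f fl.
pose F : {linear V -> 'End(V)} := HB.pack f fL.
by rewrite -[f]/(F : V -> _) lfunE /= fE.
Qed.

Definition dot_g (v w : g) : R := - killing ad (theta v) w.

Variable ip : {dot V for (@idfun R)}.

(* [adjoint A] and [moment x] are determined by the property they are picked
   for; [dot_pairs] does not depend on the orthonormal basis [onb]. *)
Definition adjoint (A : 'End(V)) : 'End(V) :=
  xget 0 [set B : 'End(V) | forall X Y, ip (A X) Y = ip X (B Y)].

Definition orthonormal_basis (e : (\dim {:V}).-tuple V) :=
  basis_of fullv e && orthonormal ip e.

Definition onb : (\dim {:V}).-tuple V :=
  xget (vbasis fullv) [set e | orthonormal_basis e].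

Definition dot_pairs (x y : pairs) : R :=
  \sum_(i < \dim {:V}) \sum_(j < \dim {:V} | (i < j)%N)
     ip (x.1 onb`_i onb`_j) (y.1 onb`_i onb`_j)
  + \sum_(i < \dim {:V}) dot_g (x.2 onb`_i) (y.2 onb`_i).

Definition dot_gc (a b : gc) : R :=
  lfun_tr (a.1 \o adjoint b.1)%VF - killing ad (theta a.2) b.2.

Definition moment (x : pairs) : gc :=
  xget 0 [set m : gc | forall a : gc, dot_gc m a = dot_pairs (act a x) x].

(* For x = 0, [kappa x] is the junk value 0 / 0 = 0; [Du x].2 does not involve
   it. *)
Definition kappa (x : pairs) : R :=
  dot_gc (moment x) (moment x) / dot_pairs x x.

Definition Du (x : pairs) : gc := moment x + kappa x *: ((\1%VF, 0) : gc).

Definition energy (x : pairs) : R :=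
  dot_gc (moment x) (moment x) / dot_pairs x x ^+ 2.

(* [energy] is invariant under scaling, so its critical points on the
   projective space of V_n(g) are the classes of the nonzero pairs at which
   all its directional derivatives along V_n(g) vanish. *)
Definition critical (x : pairs) :=
  [/\ in_Ln x, x != 0 &
      forall w : pairs, in_Vn w ->
        is_derive (0 : R) (1 : R) (fun t : R => energy (x + t *: w)) (0 : R)].

End Pairs.

Section Restriction.
Variables (R : realType) (g V : vectType R) (U : {vspace V}).
Variable ip : {dot V for (@idfun R)}.

Definition restr_dot (X Y : subvs_of U) : R := ip (vsval X) (vsval Y).

Lemma restr_dot_bilinear :
  bilinear_for (GRing.Scale.Law.clone _ _ *%R _)
    (GRing.Scale.Law.clone _ _ (@idfun R \; *%R) _) restr_dot.
Proof.
by split=> X c Y Z; rewrite /restr_dot linearP /= ?linearPl ?linearPr.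
Qed.

HB.instance Definition _ :=
  bilinear_isBilinear.Build R (subvs_of U) (subvs_of U) R _ _ restr_dot
    restr_dot_bilinear.

Lemma restr_dot_herm (X Y : subvs_of U) :
  restr_dot X Y = (-1) ^+ false * idfun (restr_dot Y X).
Proof. exact: hermC. Qed.

HB.instance Definition _ :=
  isHermitianSesquilinear.Build R (subvs_of U) false (@idfun R) restr_dot
    restr_dot_herm.

Lemma restr_dot_gt0 (X : subvs_of U) : X != 0 -> 0 < restr_dot X X.
Proof. by move=> X0; apply: neq0_dnorm_gt0. Qed.

HB.instance Definition _ :=
  isDotProduct.Build R (subvs_of U) restr_dot restr_dot_gt0.

(* Meaningful when U is a subalgebra for mu: see [restr_bracketE]. *)
Definition restr_bracket (mu : 'Hom(V, 'End(V))) :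
    'Hom(subvs_of U, 'End(subvs_of U)) :=
  linfun (fun X => (linfun (vsproj U) \o mu (vsval X) \o linfun vsval)%VF).

Definition restr (x : pairs g V) : pairs g (subvs_of U) :=
  (restr_bracket x.1, (x.2 \o linfun vsval)%VF).

Lemma restr_bracketE mu X Y :
  subalgebra mu U ->
  vsval (restr_bracket mu X Y) = mu (vsval X) (vsval Y).
Proof.
move=> Usub; rewrite /restr_bracket; set f := (fun X => _).
have fE Z W : f Z W = vsproj U (mu (vsval Z) (vsval W)).
  by rewrite /f !comp_lfunE !lfunE.
have fl : linear f.
  clearbody f => c u v; apply/lfunP => w.
  rewrite add_lfunE /= scale_lfunE !fE !linearD !linearZ /=.
  by rewrite add_lfunE /= scale_lfunE linearD linearZ.
pose fL := GRing.isLinear.Build _ _ _ _ f fl.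
pose F : {linear subvs_of U -> 'End(subvs_of U)} := HB.pack f fL.
rewrite -[f]/(F : subvs_of U -> _) lfunE /= fE vsprojK //.
by apply: Usub; apply: subvsP.
Qed.

Lemma restr_homE x X : (restr x).2 X = x.2 (vsval X).
Proof. by rewrite comp_lfunE lfunE. Qed.

End Restriction.

(* Main.v *)
Require Import Defs.
From HB Require Import structures.
From mathcomp Require Import all_boot all_order all_algebra.
From mathcomp Require Import sesquilinear spectral.
From mathcomp Require Import complex.
From mathcomp Require Import all_classical all_reals all_analysis.
From mathcomp Require Import ring lra.

(** Write x = (mu, phi), M for its moment, k = kappa x and (D, u) = Du x, so
   that (D, u) = M + k (id, 0).  Differentiating the energy along V_n shows that
   a nonzero x in L_n is critical iff (D, u) annihilates x ([criticalP]); the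
   derivation D is symmetric because M is its own adjoint.

   The engine is the identity |a^* x|^2 = <[(D, u), a], a> for every a that
   annihilates x ([norm_act_gadj]).  Applied to a = (ad X, phi X), whose bracket
   with (D, u) is (ad DX, phi DX), it yields two facts: the eigenvalues of D are
   nonnegative ([Du_eigen_ge0]), and for DX = 0 the adjoint of (ad X, phi X)
   annihilates x as well ([ker_act_gadj]).  In particular (ad X)^* is then a
   derivation.

   The decomposition needs only these facts about ad and D.  The nilradical is
   n = im D + center: im D is spanned by the eigenvectors of positive eigenvalue,
   hence is a nilpotent ideal.  Since (ad X)^* preserves n for X in ker D, the
   orthogonal complement r of n, which lies in ker D, is a subalgebra all of whose
   ad X have adjoints that are derivations.  In such an algebra the solvable
   ideals are central ([abelian_ideal_central], [solvable_ideal_central]): for an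
   abelian ideal I, evaluating the Killing form at Y in I and (ad [X, Y])^* X
   gives the square norm of ad [X, Y].  So the center a of r and its complement m
   in r give the radical a + n and the Levi factor m.  A nilpotent ideal projects
   into a; an element of a acts by a normal operator, nilpotent if it comes from
   a nilpotent ideal, hence zero ([nilpotent_ideal_sub]).

   It remains to compare the moments of x and of its restriction to n.  Splitting
   the sums over an orthonormal basis of R^n along r and n, the difference is
   governed by the sum over an orthonormal basis (X_i) of r of the commutators of
   (ad X_i, phi X_i) with their adjoints.  That sum is (ad Z, phi Z) up to sign,
   with Z the sum of the (ad X_i)^* X_i, and Z = 0 because |Z|^2 is minus the
   trace of ad Z on r, a sum of traces of commutators ([trace_vec_eq0]).  Hence
   the moment of the restriction is the compression of M ([moment_restr]), and
   its kappa is k since <M, (D, u)> = 0 on both sides ([Du_restr]). *)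

Set Implicit Arguments.
Unset Strict Implicit.
Unset Printing Implicit Defensive.

Import Order.TTheory GRing.Theory Num.Theory.
Import numFieldNormedType.Exports.

Local Open Scope ring_scope.

(** * Linear maps and traces *)

Lemma scale_add_sub (K : pzRingType) (U : lmodType K) (c : K) (a b p q : U) :
  c *: a + b - (c *: p + q) = c *: (a - p) + (b - q).
Proof. by rewrite scalerBr opprD addrACA. Qed.

Section LinearMaps.
Variables (K : fieldType) (aT rT : vectType K).

Lemma linfun_ext (f : aT -> rT) : linear f -> linfun f =1 f.
Proof.
move=> fl; pose fL := GRing.isLinear.Build _ _ _ _ f fl.
pose F : {linear aT -> rT} := HB.pack f fL.
exact: (lfunE F).
Qed.

(* Specializations to fun_of_lfun: unlike linearP and its variants, they cannot
   rewrite under another linear function such as the opposite. *)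
Lemma lfunL (f : 'Hom(aT, rT)) c x y : f (c *: x + y) = c *: f x + f y.
Proof. exact: linearP. Qed.
Lemma lfunD (f : 'Hom(aT, rT)) x y : f (x + y) = f x + f y.
Proof. exact: linearD. Qed.
Lemma lfunN (f : 'Hom(aT, rT)) x : f (- x) = - f x.
Proof. exact: linearN. Qed.
Lemma lfunZ (f : 'Hom(aT, rT)) c x : f (c *: x) = c *: f x.
Proof. exact: linearZ. Qed.
Lemma lfun0 (f : 'Hom(aT, rT)) : f 0 = 0.
Proof. exact: linear0. Qed.

Lemma lfun2_linl (f : 'Hom(aT, 'End(rT))) c x y z :
  f (c *: x + y) z = c *: f x z + f y z.
Proof. by rewrite linearP add_lfunE scale_lfunE. Qed.

End LinearMaps.

Definition lfunE_lin := (lfunD, lfunN, lfunZ, lfun0).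
Definition lfunE_op := (add_lfunE, opp_lfunE, scale_lfunE, comp_lfunE,
  id_lfunE, zero_lfunE).

Section TraceAnyBasis.
Import passmx.
Variables (K : fieldType) (V : vectType K).
Implicit Types f g : 'End(V).

(** Expanding the vectors of each basis in the other turns both traces into the
   same double sum of products of coordinates. *)
Lemma lfun_tr_basis f (b : (\dim {:V}).-tuple V) : basis_of fullv b ->
  lfun_tr f = \sum_(i < \dim {:V}) coord b i (f b`_i).
Proof.
move=> bb; rewrite /lfun_tr /mxtrace.
pose v := vbasis {:V}.
have vb : basis_of {:V} v by exact: vbasisP.
transitivity (\sum_(i < \dim {:V}) coord v i (f v`_i)).
  by apply: eq_bigr => i _; rewrite !mxE /= vecof_delta.
transitivity (\sum_(i < \dim {:V}) \sum_(j < \dim {:V})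
    coord b j (f v`_i) * coord v i b`_j).
  apply: eq_bigr => i _.
  rewrite {1}[f _](coord_basis bb) ?memvf// linear_sum; apply: eq_bigr => j _.
  by rewrite linearZ.
rewrite exchange_big; apply: eq_bigr => j _ /=.
rewrite [in RHS](coord_basis vb (memvf b`_j)) !linear_sum; apply: eq_bigr => i _.
by rewrite !linearZ mulrC.
Qed.

Lemma lfun_trC f g : lfun_tr (f \o g)%VF = lfun_tr (g \o f)%VF.
Proof.
by rewrite /lfun_tr !(mxof_comp _ _ (vbasisP fullv)) mxtrace_mulC.
Qed.

Lemma lfun_tr_linear c f g : lfun_tr (c *: f + g) = c * lfun_tr f + lfun_tr g.
Proof. by rewrite /lfun_tr mxof_linear mxtraceD mxtraceZ. Qed.

Lemma lfun_trD f g : lfun_tr (f + g) = lfun_tr f + lfun_tr g.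
Proof. by rewrite -{1}[f]scale1r lfun_tr_linear mul1r. Qed.

Lemma lfun_tr0 : lfun_tr (0 : 'End(V)) = 0.
Proof. by have := lfun_tr_linear (-1) 0 0; rewrite scaler0 addr0 mulN1r addNr. Qed.

Lemma lfun_trZ c f : lfun_tr (c *: f) = c * lfun_tr f.
Proof. by rewrite -[c *: f]addr0 lfun_tr_linear lfun_tr0 addr0. Qed.

Lemma lfun_trN f : lfun_tr (- f) = - lfun_tr f.
Proof. by rewrite -scaleN1r lfun_trZ mulN1r. Qed.

Lemma lfun_trB f g : lfun_tr (f - g) = lfun_tr f - lfun_tr g.
Proof. by rewrite lfun_trD lfun_trN. Qed.

End TraceAnyBasis.

(** * Euclidean spaces and the spectral theorem *)

Section Euclid.
Import passmx.
Variables (R : realType) (V : vectType R) (ip : {dot V for (@idfun R)}).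
Implicit Types (x y z : V) (A B D : 'End(V)).

Lemma ipC x y : ip x y = ip y x.
Proof. by rewrite hermC /= expr0 mul1r. Qed.

Lemma ip_linl c x y z : ip (c *: x + y) z = c * ip x z + ip y z.
Proof. by rewrite linearPl. Qed.
Lemma ip_linr c x y z : ip z (c *: x + y) = c * ip z x + ip z y.
Proof. by rewrite !(ipC z) ip_linl. Qed.
Lemma ipDl x y z : ip (x + y) z = ip x z + ip y z.
Proof. by rewrite -{1}(scale1r x) ip_linl mul1r. Qed.
Lemma ipDr x y z : ip z (x + y) = ip z x + ip z y.
Proof. by rewrite !(ipC z) ipDl. Qed.
Lemma ip0l x : ip 0 x = 0.
Proof. by rewrite linear0l. Qed.
Lemma ip0r x : ip x 0 = 0. Proof. by rewrite ipC ip0l. Qed.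
Lemma ipZl c x y : ip (c *: x) y = c * ip x y.
Proof. by rewrite -[c *: x]addr0 ip_linl ip0l addr0. Qed.
Lemma ipZr c x y : ip y (c *: x) = c * ip y x.
Proof. by rewrite !(ipC y) ipZl. Qed.
Lemma ipNl x y : ip (- x) y = - ip x y.
Proof. by rewrite -scaleN1r ipZl mulN1r. Qed.
Lemma ipNr x y : ip y (- x) = - ip y x.
Proof. by rewrite !(ipC y) ipNl. Qed.
Lemma ipBl x y z : ip (x - y) z = ip x z - ip y z.
Proof. by rewrite ipDl ipNl. Qed.
Lemma ipBr x y z : ip z (x - y) = ip z x - ip z y.
Proof. by rewrite ipDr ipNr. Qed.
Lemma ip_suml I r (P : pred I) F x :
  ip (\sum_(i <- r | P i) F i) x = \sum_(i <- r | P i) ip (F i) x.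
Proof.
by apply: (big_morph (fun y => ip y x)) => [y z|]; rewrite ?ipDl ?ip0l.
Qed.
Lemma ip_sumr I r (P : pred I) F x :
  ip x (\sum_(i <- r | P i) F i) = \sum_(i <- r | P i) ip x (F i).
Proof. by rewrite ipC ip_suml; apply: eq_bigr => i _; rewrite ipC. Qed.
Lemma ip_gt0 x : x != 0 -> 0 < ip x x.
Proof. exact: neq0_dnorm_gt0. Qed.
Lemma ip_eq0 x : ip x x = 0 -> x = 0.
Proof. by move=> xx; apply/eqP/negP => /negP/ip_gt0; rewrite xx ltxx. Qed.
Lemma ip_ge0 x : 0 <= ip x x.
Proof. by have [->|/ip_gt0/ltW//] := eqVneq x 0; rewrite ip0l. Qed.
Lemma ip_extl x y : (forall z, ip x z = ip y z) -> x = y.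
Proof.
move=> E; apply/eqP; rewrite -subr_eq0; apply/eqP/ip_eq0.
by rewrite {1}ipBl E subrr.
Qed.

Lemma orthonormal_cons v s : orthonormal ip (v :: s) <->
  [/\ ip v v = 1, forall u, u \in s -> ip v u = 0 & orthonormal ip s].
Proof.
rewrite /orthonormal /= andbT; split.
  case/andP=> /andP[/eqP v1 n1] /andP[/allP vs os]; split=> //.
    by move=> u /vs/eqP.
  by rewrite n1.
case=> v1 vs /andP[n1 os]; rewrite v1 eqxx n1 os /= andbT.
by apply/allP => u us; rewrite /= vs.
Qed.

Lemma orthonormal_nth s i j : orthonormal ip s ->
  (i < size s)%N -> (j < size s)%N -> ip s`_i s`_j = (i == j)%:R.
Proof.
elim: s i j => [//|v s IH] [|i] [|j] /orthonormal_cons[v1 vs os] //= ilt jlt.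
- by rewrite vs// mem_nth.
- by rewrite ipC vs// mem_nth.
- exact: IH.
Qed.

Lemma orthonormal_tupleE n (e : n.-tuple V) (i j : 'I_n) :
  orthonormal ip e -> ip e`_i e`_j = (i == j)%:R.
Proof. by move=> oe; rewrite orthonormal_nth// size_tuple. Qed.

Lemma orthonormal_tuple_free n (e : n.-tuple V) : orthonormal ip e -> free e.
Proof.
move=> oe; apply/freeP => k k0 i.
have := congr1 (ip^~ e`_i) k0; rewrite ip0l ip_suml (bigD1 i)//= big1.
  by rewrite ipZl orthonormal_tupleE// eqxx mulr1 addr0.
by move=> j ji; rewrite ipZl orthonormal_tupleE// (negPf ji) mulr0.
Qed.

Definition selfadj A := forall x y, ip (A x) y = ip x (A y).

(** The matrix of D has a complex eigenvector X + iY, for an eigenvalue p + iq.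
   Symmetry of D gives q (|X|^2 + |Y|^2) = 0, so q = 0 and one of X, Y is an
   eigenvector. *)
Lemma selfadj_eigenvector D : (0 < \dim {:V})%N -> selfadj D ->
  exists v l, ip v v = 1 /\ D v = l *: v.
Proof.
move=> V0 Dsym.
suff [v [l [v0 Dv]]] : exists v l, v != 0 /\ D v = l *: v.
  have vv := ip_gt0 v0.
  exists ((Num.sqrt (ip v v))^-1 *: v), l; split.
    rewrite ipZl ipZr mulrA -expr2 exprVn sqr_sqrtr ?ltW//.
    by rewrite mulVf// gt_eqF.
  by rewrite linearZ /= Dv !scalerA mulrC.
pose b := vbasis {:V}; have bb : basis_of {:V} b by exact: vbasisP.
pose M := mxof b b D.
have DM u : D (vecof b u) = vecof b (u *m M).
  exact: hom_vecof.
clearbody M.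
have [[p q] /eigenvalueP[w wM w0]] :=
  eigenvalue_closed (map_mx (real_complex R) M) V0.
pose x : 'rV[R]_(\dim {:V}) := \row_j complex.Re (w 0 j).
pose y : 'rV[R]_(\dim {:V}) := \row_j complex.Im (w 0 j).
have coordM j : (\sum_i w 0 i * (M i j)%:C)%C = (p +i* q)%C * w 0 j.
  have := congr1 (fun N : 'rV_ _ => N 0 j) wM; rewrite !mxE => <-.
  by apply: eq_bigr => i _; rewrite mxE.
have xM : x *m M = p *: x - q *: y.
  apply/rowP => j; rewrite !mxE.
  have := congr1 (@complex.Re R) (coordM j); rewrite raddf_sum /=.
  case: (w 0 j) => s t /= <-; apply: eq_bigr => i _.
  by rewrite !mxE; case: (w 0 i) => u v /=; rewrite mulr0 subr0.
have yM : y *m M = q *: x + p *: y.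
  apply/rowP => j; rewrite !mxE addrC.
  have := congr1 (@complex.Im R) (coordM j); rewrite raddf_sum /=.
  case: (w 0 j) => s t /= <-; apply: eq_bigr => i _.
  by rewrite !mxE; case: (w 0 i) => u v /=; rewrite mulr0 add0r.
pose X := vecof b x; pose Y := vecof b y.
have DX : D X = p *: X - q *: Y.
  by rewrite DM xM linearB !linearZ.
have DY : D Y = q *: X + p *: Y.
  by rewrite DM yM linearD !linearZ.
have XY0 : (X != 0) || (Y != 0).
  apply: contraNT w0; rewrite negb_or !negbK => /andP[].
  rewrite !(vecof_eq0 bb) => /eqP x0 /eqP y0.
  apply/eqP/rowP => j; rewrite mxE.
  have /rowP/(_ j) := x0; have /rowP/(_ j) := y0; rewrite !mxE.
  by case: (w 0 j) => s t /= -> ->.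
have q0 : q = 0.
  have qq : q * (ip X X + ip Y Y) = 0.
    have := Dsym X Y; rewrite DX DY ipBl ipDr !ipZl !ipZr; lra.
  move/eqP: qq; rewrite mulf_eq0 => /orP[/eqP//|].
  rewrite paddr_eq0 ?ip_ge0// => /andP[/eqP/ip_eq0 X0 /eqP/ip_eq0 Y0].
  by rewrite X0 Y0 eqxx in XY0.
case/orP: XY0 => ?; [exists X, p|exists Y, p]; split=> //.
  by rewrite DX q0 scale0r subr0.
by rewrite DY q0 scale0r add0r.
Qed.

End Euclid.

Section Spectral.
Variable R : realType.

(** The orthogonal complement of an eigenvector is stable under D, whence an
   induction on the dimension.  The case D = 0 gives orthonormal bases. *)
Lemma spectral_basis (V : vectType R) (ip : {dot V for (@idfun R)}) (D : 'End(V)) :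
  selfadj ip D -> exists e : (\dim {:V}).-tuple V, orthonormal_basis ip e /\
    forall i : 'I_(\dim {:V}), exists l, D e`_i = l *: e`_i.
Proof.
suff H d : forall (V : vectType R) (ip : {dot V for (@idfun R)}) (D : 'End(V)),
    \dim {:V} = d -> selfadj ip D ->
    exists e : seq V, [/\ size e = d, orthonormal ip e &
      forall x, x \in e -> exists l, D x = l *: x].
  move=> Dsym; have [e [se oe De]] := H _ V ip D erefl Dsym.
  exists (Tuple (introT eqP se)); split.
    rewrite /orthonormal_basis oe basisEfree.
    rewrite (orthonormal_tuple_free (e := Tuple (introT eqP se)) oe)/= subvf.
    by rewrite se leqnn.
  by move=> i; apply: De; rewrite mem_nth ?se.
elim: d => [|d IH] {}V {}ip {}D dV Dsym; first by exists [::].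
have [|v [l [v1 Dv]]] := selfadj_eigenvector _ Dsym; first by rewrite dV.
pose W := orthov ip <[v]>.
have WP x : (x \in W) = (ip x v == 0) by rewrite mem_orthov1.
have dW : \dim {:subvs_of W} = d.
  rewrite dimvf /= /dim /=.
  have := @eq_dim_orthov1 R false idfun V ip v fullv.
  rewrite capfv dV /= => <-//.
  apply/mem_orthovPn; exists v; rewrite ?memvf//.
  by have v0 : ip v v != 0 by rewrite v1 oner_neq0.
pose ip' : {dot (subvs_of W) for (@idfun R)} := restr_dot ip.
pose D' : 'End(subvs_of W) := (linfun (vsproj W) \o D \o linfun vsval)%VF.
have D'E x : vsval (D' x) = D (vsval x).
  rewrite !comp_lfunE !lfunE /= vsprojK// WP Dsym Dv ipZr.
  by have := subvsP x; rewrite WP => /eqP->; rewrite mulr0.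
have [|e [se oe De]] := IH _ ip' D' dW.
  move=> x y; change (ip (vsval (D' x)) (vsval y) = ip (vsval x) (vsval (D' y))).
  by rewrite !D'E.
exists (v :: [seq vsval x | x <- e]); split.
- by rewrite /= size_map se.
- apply/orthonormal_cons; split=> //.
    by move=> _ /mapP[x _ ->]; rewrite ipC; apply/eqP; rewrite -WP subvsP.
  elim: {se De} e oe => [//|x e IHe] /orthonormal_cons[x1 xe oe].
  apply/orthonormal_cons; split; [exact: x1| |exact: IHe].
  by move=> _ /mapP[y ye ->]; apply: (xe y ye).
- move=> x; rewrite inE => /orP[/eqP->|/mapP[x' x'e ->]]; first by exists l.
  by have [k Dx] := De _ x'e; exists k; rewrite -D'E Dx.
Qed.

End Spectral.

(** * Traces of bilinear forms *)

(** Kept unbundled, as it is applied to many ad hoc forms. *)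
Definition bilin (R : realType) (V : vectType R) (b : V -> V -> R) :=
  (forall c x y z, b (c *: x + y) z = c * b x z + b y z) /\
  (forall c x y z, b z (c *: x + y) = c * b z x + b z y).

Section FormTrace.
Variables (R : realType) (V : vectType R) (ip : {dot V for (@idfun R)}).
Implicit Types (x y z : V) (A B D : 'End(V)) (b : V -> V -> R).

Lemma bilin0l b x : bilin b -> b 0 x = 0.
Proof.
by case=> bl _; have := bl (-1) 0 0 x; rewrite scaler0 addr0 mulN1r addNr.
Qed.
Lemma bilin0r b x : bilin b -> b x 0 = 0.
Proof.
by case=> _ bl; have := bl (-1) 0 0 x; rewrite scaler0 addr0 mulN1r addNr.
Qed.
Lemma bilin_suml b (I : finType) (c : I -> R) (F : I -> V) x : bilin b ->
  b (\sum_i c i *: F i) x = \sum_i c i * b (F i) x.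
Proof.
move=> bb; apply: (big_ind2 (fun y s => b y x = s)) => [|y s z t|i _].
- exact: bilin0l.
- by move=> <- <-; rewrite -{1}[y]scale1r bb.1 mul1r.
- by rewrite -[c i *: _]addr0 bb.1 (bilin0l _ bb) addr0.
Qed.
Lemma bilin_sumr b (I : finType) (c : I -> R) (F : I -> V) x : bilin b ->
  b x (\sum_i c i *: F i) = \sum_i c i * b x (F i).
Proof.
move=> bb; apply: (big_ind2 (fun y s => b x y = s)) => [|y s z t|i _].
- exact: bilin0r.
- by move=> <- <-; rewrite -{1}[y]scale1r bb.2 mul1r.
- by rewrite -[c i *: _]addr0 bb.2 (bilin0r _ bb) addr0.
Qed.
Lemma bilinDl b x y z : bilin b -> b (x + y) z = b x z + b y z.
Proof. by case=> bl _; rewrite -{1}[x]scale1r bl mul1r. Qed.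
Lemma bilinDr b x y z : bilin b -> b z (x + y) = b z x + b z y.
Proof. by case=> _ bl; rewrite -{1}[x]scale1r bl mul1r. Qed.

Lemma bilin_dot (f g : V -> V) : linear f -> linear g ->
  bilin (fun x y => ip (f x) (g y)).
Proof. by move=> fl gl; split=> c x y z; rewrite (fl, gl) (ip_linl, ip_linr). Qed.

Local Notation e := (onb ip).

Lemma onbP : orthonormal_basis ip e.
Proof.
have D0 : selfadj ip (0 : 'End(V)).
  by move=> x y; rewrite !zero_lfunE ip0l ip0r.
have [b [ob _]] := spectral_basis D0.
exact: (@xgetPex _ _ [set e | orthonormal_basis ip e] (ex_intro _ b ob)).
Qed.

Lemma onb_ip (i j : 'I_(\dim {:V})) : ip e`_i e`_j = (i == j)%:R.
Proof. by apply: orthonormal_tupleE; have /andP[] := onbP. Qed.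

Lemma onbasis_sum (b : (\dim {:V}).-tuple V) x : orthonormal_basis ip b ->
  x = \sum_(i < \dim {:V}) ip x b`_i *: b`_i.
Proof.
move=> /andP[bb ob]; rewrite {1}(coord_basis bb (memvf x)).
apply: eq_bigr => i _; congr (_ *: _).
rewrite [in RHS](coord_basis bb (memvf x)) ip_suml (bigD1 i)//= big1.
  by rewrite ipZl orthonormal_tupleE// eqxx mulr1 addr0.
by move=> j ji; rewrite ipZl orthonormal_tupleE// (negPf ji) mulr0.
Qed.

Lemma onb_sum x : x = \sum_(i < \dim {:V}) ip x e`_i *: e`_i.
Proof. exact: onbasis_sum onbP. Qed.

Lemma parseval x y : ip x y = \sum_(i < \dim {:V}) ip x e`_i * ip y e`_i.
Proof.
by rewrite {1}[y]onb_sum ip_sumr; apply: eq_bigr => i _; rewrite ipZr mulrC.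
Qed.

Lemma adjointP A x y : ip (A x) y = ip x (adjoint ip A y).
Proof.
pose f y := \sum_(i < \dim {:V}) ip (A e`_i) y *: e`_i.
have fl : linear f.
  move=> c u v; rewrite /f scaler_sumr -big_split /=; apply: eq_bigr => i _.
  by rewrite ip_linr scalerDl scalerA.
have fP : [set B : 'End(V) | forall X Y, ip (A X) Y = ip X (B Y)]%classic (linfun f).
  move=> X Y; rewrite linfun_ext// {1}[X]onb_sum linear_sum ip_suml ip_sumr.
  by apply: eq_bigr => i _; rewrite linearZ ipZl ipZr mulrC.
exact: (@xgetPex _ 0 [set B : 'End(V) | forall X Y, ip (A X) Y = ip X (B Y)]%classic
  (ex_intro _ _ fP)).
Qed.

Lemma adjointPr A x y : ip x (A y) = ip (adjoint ip A x) y.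
Proof. by rewrite ipC adjointP ipC. Qed.

Lemma adjoint_uniq A B :
  (forall x y, ip (A x) y = ip x (B y)) -> adjoint ip A = B.
Proof.
move=> AB; apply/lfunP => y; apply: (@ip_extl _ _ ip) => z.
by rewrite ipC -adjointP AB ipC.
Qed.

Lemma adjointK A : adjoint ip (adjoint ip A) = A.
Proof. by apply: adjoint_uniq => x y; rewrite ipC -adjointP ipC. Qed.

Lemma adjoint_selfadj A : selfadj ip A -> adjoint ip A = A.
Proof. exact: adjoint_uniq. Qed.

Lemma adjoint_comp A B :
  adjoint ip (A \o B)%VF = (adjoint ip B \o adjoint ip A)%VF.
Proof. by apply: adjoint_uniq => x y; rewrite !comp_lfunE !adjointP. Qed.

(** Nested uses of this trace give all the sums over orthonormal bases that enter
   the inner product of pairs. *)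
Definition form_tr b := \sum_(i < \dim {:V}) b e`_i e`_i.

Lemma eq_form_tr b c : (forall x, b x x = c x x) -> form_tr b = form_tr c.
Proof. by move=> bc; apply: eq_bigr => i _. Qed.

Lemma form_trD b c : form_tr (fun x y => b x y + c x y) = form_tr b + form_tr c.
Proof. exact: big_split. Qed.

Lemma form_trZ k b : form_tr (fun x y => k * b x y) = k * form_tr b.
Proof. by rewrite /form_tr mulr_sumr. Qed.

Lemma form_trN b : form_tr (fun x y => - b x y) = - form_tr b.
Proof. by rewrite /form_tr sumrN. Qed.

Lemma form_trB b c : form_tr (fun x y => b x y - c x y) = form_tr b - form_tr c.
Proof. by rewrite form_trD form_trN. Qed.

Lemma form_tr0 b : (forall x, b x x = 0) -> form_tr b = 0.
Proof. by move=> b0; apply: big1 => i _. Qed.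

Lemma form_tr_ge0 b : (forall x, 0 <= b x x) -> 0 <= form_tr b.
Proof. by move=> b0; apply: sumr_ge0 => i _. Qed.

(** The form vanishes on the basis vectors, so by positivity (expand
   b (t e + x) (t e + x) for a suitable t) they lie in its radical. *)
Lemma form_tr_eq0 b : bilin b -> (forall x y, b x y = b y x) ->
  (forall x, 0 <= b x x) -> form_tr b = 0 -> forall x, b x x = 0.
Proof.
move=> bb bC b0 tr0.
have bi0 (i : 'I_(\dim {:V})) : b e`_i e`_i = 0.
  exact: (psumr_eq0P _ tr0).
have bij x (i : 'I_(\dim {:V})) : b x e`_i = 0.
  have [->//|xx0] := eqVneq (b x e`_i) 0.
  have Q t : 0 <= b x x + t * (2 * b x e`_i).
    by have := b0 (t *: e`_i + x); rewrite bb.1 !bb.2 bi0 (bC e`_i x); lra.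
  have := Q (- (b x x + 1) / (2 * b x e`_i)).
  by rewrite divfK ?mulf_neq0 ?pnatr_eq0//; lra.
move=> x; rewrite {2}[x]onb_sum bilin_sumr//.
by rewrite big1// => i _; rewrite bij mulr0.
Qed.

Lemma exchange_form_tr (F : V -> V -> V -> V -> R) :
  form_tr (fun x y => form_tr (F x y)) =
  form_tr (fun z w => form_tr (fun x y => F x y z w)).
Proof. exact: exchange_big. Qed.

Lemma bilin_form_tr (U : vectType R) (F : U -> U -> V -> V -> R) :
  (forall x, bilin (fun u v : U => F u v x x)) ->
  bilin (fun u v : U => form_tr (F u v)).
Proof.
by move=> Fb; split=> c u v w; rewrite -form_trZ -form_trD;
  apply: eq_form_tr => x; [exact: (Fb x).1|exact: (Fb x).2].
Qed.

(** Moving an operator across a form: this one rule replaces all changes of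
   orthonormal bases. *)
Lemma form_tr_shift b A : bilin b ->
  form_tr (fun x y => b (A x) y) = form_tr (fun x y => b x (adjoint ip A y)).
Proof.
move=> bb; rewrite /form_tr.
under eq_bigr => i _ do rewrite {1}[A _]onb_sum bilin_suml//.
under [RHS]eq_bigr => i _ do rewrite {1}[adjoint _ _ _]onb_sum bilin_sumr//.
rewrite exchange_big; apply: eq_bigr => i _; apply: eq_bigr => j _.
by rewrite -adjointPr ipC.
Qed.

Lemma form_tr_shiftr b A : bilin b ->
  form_tr (fun x y => b x (A y)) = form_tr (fun x y => b (adjoint ip A x) y).
Proof. by move=> bb; rewrite form_tr_shift// adjointK. Qed.

Lemma lfun_trE A : lfun_tr A = form_tr (fun x y => ip (A x) y).
Proof.
have /andP[eb eo] := onbP; rewrite (lfun_tr_basis A eb); apply: eq_bigr => i _.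
rewrite [in RHS](coord_basis eb (memvf (A _))) ip_suml (bigD1 i)//= big1.
  by rewrite ipZl onb_ip eqxx mulr1 addr0.
by move=> j ji; rewrite ipZl onb_ip (negPf ji) mulr0.
Qed.

Lemma lfun_tr_adjoint A : lfun_tr (adjoint ip A) = lfun_tr A.
Proof. by rewrite !lfun_trE; apply: eq_form_tr => x; rewrite -adjointPr ipC. Qed.

Lemma lfun_tr_ge0 A : 0 <= lfun_tr (A \o adjoint ip A)%VF.
Proof.
rewrite lfun_trE; apply: form_tr_ge0 => x.
by rewrite comp_lfunE adjointP ip_ge0.
Qed.

Lemma lfun_tr_eq0 A : lfun_tr (A \o adjoint ip A)%VF = 0 -> A = 0.
Proof.
rewrite lfun_trC lfun_trE => A0; apply/lfunP => x; rewrite zero_lfunE.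
apply: (@ip_eq0 _ _ ip).
have Ab : bilin (fun x y => ip (A x) (A y)).
  by apply: bilin_dot => c u v; rewrite linearP.
apply: (form_tr_eq0 Ab) => [u v|u|]; [exact: ipC|exact: ip_ge0|].
by rewrite -A0; apply: eq_form_tr => u; rewrite comp_lfunE adjointPr.
Qed.

End FormTrace.

Section OrthogonalProjection.
Variables (R : realType) (V : vectType R) (ip : {dot V for (@idfun R)}).
Variable (U : {vspace V}).
Implicit Types (x y z : V) (A B D : 'End(V)) (b : V -> V -> R).

Definition subdot : {dot (subvs_of U) for (@idfun R)} := restr_dot ip.

Lemma subdotE (x y : subvs_of U) : subdot x y = ip (vsval x) (vsval y).
Proof. by []. Qed.

Local Notation f := (onb subdot).

Definition oproj : 'End(V) :=
  linfun (fun x => \sum_(i < \dim {:subvs_of U}) ip x (vsval f`_i) *: vsval f`_i).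

Lemma oprojE x :
  oproj x = \sum_(i < \dim {:subvs_of U}) ip x (vsval f`_i) *: vsval f`_i.
Proof.
rewrite linfun_ext// => c u v; rewrite scaler_sumr -big_split /=.
by apply: eq_bigr => i _; rewrite ip_linl scalerDl scalerA.
Qed.

Lemma memv_oproj x : oproj x \in U.
Proof. by rewrite oprojE memv_suml// => i _; rewrite memvZ// subvsP. Qed.

Lemma oproj_id x : x \in U -> oproj x = x.
Proof.
move=> xU; rewrite oprojE -[in RHS](vsprojK xU) [vsproj U x](onb_sum subdot).
rewrite [RHS]linear_sum; apply: eq_bigr => i _.
by rewrite linearZ subdotE /= vsprojK.
Qed.

Lemma oproj_selfadj : selfadj ip oproj.
Proof.
move=> x y; rewrite !oprojE ip_suml ip_sumr; apply: eq_bigr => i _.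
by rewrite ipZl ipZr (ipC ip (vsval _) y) mulrC.
Qed.

Lemma oprojK x : oproj (oproj x) = oproj x.
Proof. by rewrite oproj_id ?memv_oproj. Qed.

Definition coproj : 'End(V) := \1%VF - oproj.

Lemma coprojE x : coproj x = x - oproj x.
Proof. by rewrite /coproj add_lfunE opp_lfunE id_lfunE. Qed.

Lemma coproj_selfadj : selfadj ip coproj.
Proof. by move=> x y; rewrite !coprojE ipBl ipBr oproj_selfadj. Qed.

Lemma ip_coproj x y : y \in U -> ip (coproj x) y = 0.
Proof. by move=> yU; rewrite coproj_selfadj coprojE oproj_id// subrr ip0r. Qed.

Lemma oproj_coproj x : oproj x + coproj x = x.
Proof. by rewrite coprojE addrC subrK. Qed.

Lemma coproj_id x : (forall y, y \in U -> ip x y = 0) -> coproj x = x.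
Proof.
move=> xU; rewrite coprojE (_ : oproj x = 0) ?subr0//.
by apply: (@ip_eq0 _ _ ip); rewrite oproj_selfadj oprojK xU ?memv_oproj.
Qed.

(** A sum over an orthonormal basis of U becomes a sum over one of V, so that
   quantities attached to U can be compared with those attached to V without
   choosing an adapted basis. *)
Lemma form_tr_oproj b : bilin b ->
  form_tr subdot (fun x y : subvs_of U => b (vsval x) (vsval y)) =
  form_tr ip (fun x y => b (oproj x) (oproj y)).
Proof.
move=> bb; rewrite /form_tr.
under [RHS]eq_bigr => i _ do rewrite {1}oprojE bilin_suml//.
rewrite exchange_big; apply: eq_bigr => j _ /=.
have bP : bilin (fun x y => b x (oproj y)).
  by split=> c x y z; rewrite ?linearP ?bb.1 ?bb.2.
under eq_bigr => i _ do rewrite (ipC ip).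
rewrite -(bilin_sumr _ _ _ bP) -(onb_sum ip) oproj_id//; exact: subvsP.
Qed.

(** The cross terms vanish: shifting one projection across the form composes it
   with the complementary one. *)
Lemma form_tr_split b : bilin b -> form_tr ip b =
  form_tr ip (fun x y => b (oproj x) (oproj y)) +
  form_tr ip (fun x y => b (coproj x) (coproj y)).
Proof.
move=> bb.
have cross : form_tr ip (fun x y => b (oproj x) (coproj y)) = 0.
  have bQ : bilin (fun x y => b x (coproj y)).
    by split=> c x y z; rewrite ?linearP ?bb.1 ?bb.2.
  rewrite (form_tr_shift _ _ bQ) (adjoint_selfadj oproj_selfadj).
  apply: form_tr0 => x; rewrite coprojE oprojK subrr; exact: bilin0r.
have cross' : form_tr ip (fun x y => b (coproj x) (oproj y)) = 0.
  have bQ : bilin (fun x y => b (coproj x) y).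
    by split=> c x y z; rewrite ?linearP ?bb.1 ?bb.2.
  rewrite (form_tr_shiftr _ _ bQ) (adjoint_selfadj oproj_selfadj).
  apply: form_tr0 => x; rewrite coprojE oprojK subrr; exact: bilin0l.
transitivity (form_tr ip (fun x y => b (oproj x) (oproj y) +
    b (oproj x) (coproj y) + (b (coproj x) (oproj y) + b (coproj x) (coproj y)))).
  apply: eq_form_tr => x; rewrite -!(bilinDr _ _ _ bb) oproj_coproj.
  by rewrite -(bilinDl _ _ _ bb) oproj_coproj.
by rewrite !form_trD cross cross' addr0 add0r.
Qed.

End OrthogonalProjection.

Section Riesz.
Variables (R : realType) (W : vectType R) (b : W -> W -> R).

(** A form without isotropic vectors embeds W in its dual, and the dimensions
   agree. *)
Lemma riesz (l : W -> R) : bilin b -> (forall w, b w w = 0 -> w = 0) ->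
  (forall c x y, l (c *: x + y) = c * l x + l y) ->
  exists w, forall v, b w v = l v.
Proof.
move=> bb b0 ll; pose e := vbasis {:W}.
pose f (w : W) : 'rV[R]_(\dim {:W}) := \row_i b w e`_i.
have fl : linear f.
  by move=> c x y; apply/rowP => i; rewrite !mxE bb.1.
have be w v : b w v = \sum_(i < \dim {:W}) coord e i v * b w e`_i.
  by rewrite {1}[v](coord_vbasis (memvf v)) bilin_sumr.
have lsum v : l v = \sum_(i < \dim {:W}) coord e i v * l e`_i.
  rewrite {1}[v](coord_vbasis (memvf v)).
  have l0 : l 0 = 0.
    by have := ll (-1) 0 0; rewrite scaler0 addr0 mulN1r addNr.
  apply: (big_ind2 (fun y s => l y = s)) => [//|y s z t <- <-|i _].
    by rewrite -{1}[y]scale1r ll mul1r.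
  by rewrite -[_ *: _]addr0 ll l0 addr0.
have kerf : (fullv :&: lker (linfun f) = 0)%VS.
  apply/eqP; rewrite capfv -subv0; apply/subvP => w; rewrite memv_ker linfun_ext//.
  move=> /eqP fw; rewrite memv0; apply/eqP/b0; rewrite be big1// => i _.
  by have /rowP/(_ i) := fw; rewrite !mxE => ->; rewrite mulr0.
have fsurj : limg (linfun f) = fullv.
  apply/eqP; rewrite eqEdim subvf (limg_dim_eq kerf) [in X in (X <= _)%N]dimvf.
  by rewrite dimvf /dim /= mul1n.
have : (\row_i l e`_i : 'rV[R]_(\dim {:W})) \in limg (linfun f).
  by rewrite fsurj memvf.
move=> /memv_imgP[w _ wl]; exists w => v; rewrite be lsum.
apply: eq_bigr => i _; congr (_ * _).
by move: wl; rewrite linfun_ext// => /rowP/(_ i); rewrite !mxE.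
Qed.

End Riesz.

(** * Killing forms and the inner product of a semisimple Lie algebra *)

Section LieBasics.
Variables (K : fieldType) (V : vectType K) (br : 'Hom(V, 'End(V))).
Hypothesis brL : lie_bracket br.

Lemma br_anti x y : br x y = - br y x.
Proof.
have [alt _] := brL; have := alt (x + y).
rewrite !linearD /= !add_lfunE !alt add0r addr0 => /eqP.
by rewrite addrC addr_eq0 => /eqP.
Qed.

Lemma br_jacobi x y z : br (br x y) z = br x (br y z) - br y (br x z).
Proof.
have [_ /(_ x y z)/eqP] := brL.
rewrite (br_anti (br x y)) (br_anti z x) linearN /=.
by rewrite addr_eq0 => /eqP <-.
Qed.

Lemma br_ad x y : br (br x y) = (br x \o br y)%VF - (br y \o br x)%VF.
Proof.
by apply/lfunP => z; rewrite add_lfunE opp_lfunE !comp_lfunE br_jacobi.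
Qed.

Lemma killing_linl c x y z :
  killing br (c *: x + y) z = c * killing br x z + killing br y z.
Proof.
rewrite /killing -lfun_tr_linear; congr lfun_tr; apply/lfunP => v.
by rewrite !(add_lfunE, scale_lfunE, comp_lfunE) linearP add_lfunE scale_lfunE.
Qed.

Lemma killingC x y : killing br x y = killing br y x.
Proof. exact: lfun_trC. Qed.

Lemma killingNl x y : killing br (- x) y = - killing br x y.
Proof. by rewrite /killing linearN comp_lfunNl lfun_trN. Qed.

Lemma killingNr x y : killing br y (- x) = - killing br y x.
Proof. by rewrite !(killingC y) killingNl. Qed.

Lemma killing_inv x y z : killing br (br x y) z = killing br x (br y z).
Proof.
rewrite /killing !br_ad (comp_lfunDl, comp_lfunDr) comp_lfunNl.
rewrite [in RHS]comp_lfunDr comp_lfunNr !lfun_trB -!comp_lfunA; congr (_ - _).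
by rewrite lfun_trC -!comp_lfunA.
Qed.

End LieBasics.

Section CartanForm.
Variables (R : realType) (g : vectType R).
Variables (ad : 'Hom(g, 'End(g))) (theta : 'End(g)).
Hypotheses (adL : lie_bracket ad) (thetaC : cartan_involution ad theta).

Local Notation dotg := (dot_g ad theta).

Lemma killing_theta x y : killing ad (theta x) (theta y) = killing ad x y.
Proof.
have [inv hom _] := thetaC; rewrite /killing.
have adth z : ad (theta z) = (theta \o (ad z \o theta))%VF.
  by apply/lfunP => v; rewrite !comp_lfunE hom inv.
rewrite !adth -!comp_lfunA (comp_lfunA theta theta).
have -> : (theta \o theta)%VF = \1%VF.
  by apply/lfunP => v; rewrite comp_lfunE id_lfunE inv.
rewrite comp_lfun1l lfun_trC -!comp_lfunA.
have -> : (theta \o theta)%VF = \1%VF.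
  by apply/lfunP => v; rewrite comp_lfunE id_lfunE inv.
by rewrite comp_lfun1r.
Qed.

Lemma dotgC v w : dotg v w = dotg w v.
Proof.
have [inv _ _] := thetaC.
by rewrite /dot_g -killing_theta inv killingC.
Qed.

Lemma dotg_linl c x y z : dotg (c *: x + y) z = c * dotg x z + dotg y z.
Proof. by rewrite /dot_g linearP killing_linl opprD mulrN. Qed.

Lemma dotg_linr c x y z : dotg z (c *: x + y) = c * dotg z x + dotg z y.
Proof. by rewrite !(dotgC z) dotg_linl. Qed.

Lemma dotg_bilin : bilin dotg.
Proof. by split=> *; rewrite (dotg_linl, dotg_linr). Qed.

Lemma dotg_gt0 v : v != 0 -> 0 < dotg v v.
Proof. by have [_ _] := thetaC; apply. Qed.

Lemma dotg0l v : dotg 0 v = 0. Proof. exact: bilin0l dotg_bilin. Qed.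

Lemma dotg_ge0 v : 0 <= dotg v v.
Proof. by have [->|/dotg_gt0/ltW//] := eqVneq v 0; rewrite dotg0l. Qed.

Lemma dotg_eq0 v : dotg v v = 0 -> v = 0.
Proof. by move=> vv; apply/eqP/negP => /negP/dotg_gt0; rewrite vv ltxx. Qed.

Lemma dotgDl x y z : dotg (x + y) z = dotg x z + dotg y z.
Proof. exact: bilinDl dotg_bilin. Qed.

Lemma dotgZl c x y : dotg (c *: x) y = c * dotg x y.
Proof. by rewrite -[c *: x]addr0 dotg_linl dotg0l addr0. Qed.

Lemma dotgNl x y : dotg (- x) y = - dotg x y.
Proof. by rewrite -scaleN1r dotgZl mulN1r. Qed.

Lemma dotgNr x y : dotg y (- x) = - dotg y x.
Proof. by rewrite !(dotgC y) dotgNl. Qed.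

Lemma dotgDr x y z : dotg z (x + y) = dotg z x + dotg z y.
Proof. by rewrite !(dotgC z) dotgDl. Qed.

Lemma dotg_extl u v : (forall w, dotg u w = dotg v w) -> u = v.
Proof.
move=> E; apply/eqP; rewrite -subr_eq0; apply/eqP/dotg_eq0.
by rewrite dotgDl dotgNl E subrr.
Qed.

(** The adjoint of ad v is ad (- theta v). *)
Lemma dotg_ad v x y : dotg (ad v x) y = dotg x (ad (- theta v) y).
Proof.
have [_ hom _] := thetaC.
rewrite /dot_g hom (br_anti adL) killingNl opprK (killing_inv adL).
by rewrite linearN opp_lfunE killingNr opprK.
Qed.

End CartanForm.

(** * The space of pairs and the action *)

(* Identities between vectors are proved by pairing with an arbitrary vector. *)
Ltac ip_ring ip := apply: (@ip_extl _ _ ip) => ?;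
  rewrite !(ipDl, ipNl, ipZl); ring.
Ltac dotg_ring thetaC := apply: (dotg_extl thetaC) => ?;
  rewrite !(dotgDl thetaC, dotgNl thetaC, dotgZl thetaC); ring.

Section PairForms.
Variables (R : realType) (g V : vectType R).
Variables (ad : 'Hom(g, 'End(g))) (theta : 'End(g)).
Variable ip : {dot V for (@idfun R)}.
Hypotheses (adL : lie_bracket ad) (thetaC : cartan_involution ad theta).
Implicit Types (x y z w : pairs g V) (a b c : gc g V) (X Y Z : V).

Local Notation dotg := (dot_g ad theta).

(** Half the sum over all ordered pairs of basis vectors: unlike the sum over
   i < j it is definite on all pairs, and it is a nested [form_tr]; both agree on
   alternating pairs ([dot_pairsE]). *)
Definition pairdot x y : R :=
  2^-1 * form_tr ip (fun X X' => form_tr ip (fun Y Y' =>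
    ip (x.1 X Y) (y.1 X' Y'))) +
  form_tr ip (fun X X' => dotg (x.2 X) (y.2 X')).

Lemma bilin_bracket1 x y Y Y' : bilin (fun X X' => ip (x.1 X Y) (y.1 X' Y')).
Proof. by apply: bilin_dot => k X Z; rewrite lfun2_linl. Qed.

Lemma bilin_bracket2 x y X X' : bilin (fun Y Y' => ip (x.1 X Y) (y.1 X' Y')).
Proof. by apply: bilin_dot => k Y Z; rewrite linearP. Qed.

Lemma pairdotC x y : pairdot x y = pairdot y x.
Proof.
have E1 : form_tr ip (fun X X' => dotg (x.2 X) (y.2 X')) =
    form_tr ip (fun X X' => dotg (y.2 X) (x.2 X')).
  by apply: eq_form_tr => X; exact: (dotgC thetaC).
rewrite /pairdot E1; congr (_ * _ + _).
by apply: eq_form_tr => X; apply: eq_form_tr => Y; exact: ipC.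
Qed.

Lemma pairdot_linl k x y z :
  pairdot (k *: x + y) z = k * pairdot x z + pairdot y z.
Proof.
have E1 : form_tr ip (fun X X' => dotg ((k *: x + y).2 X) (z.2 X')) =
    k * form_tr ip (fun X X' => dotg (x.2 X) (z.2 X')) +
    form_tr ip (fun X X' => dotg (y.2 X) (z.2 X')).
  rewrite -form_trZ -form_trD; apply: eq_form_tr => X.
  by rewrite /= add_lfunE scale_lfunE dotg_linl.
have E2 : form_tr ip (fun X X' => form_tr ip (fun Y Y' =>
      ip ((k *: x + y).1 X Y) (z.1 X' Y'))) =
    k * form_tr ip (fun X X' => form_tr ip (fun Y Y' =>
      ip (x.1 X Y) (z.1 X' Y'))) +
    form_tr ip (fun X X' => form_tr ip (fun Y Y' => ip (y.1 X Y) (z.1 X' Y'))).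
  rewrite -form_trZ -form_trD; apply: eq_form_tr => X.
  rewrite -form_trZ -form_trD; apply: eq_form_tr => Y.
  by rewrite /= !(add_lfunE, scale_lfunE) ip_linl.
by rewrite /pairdot E1 E2; ring.
Qed.

Lemma pairdot_bilin : bilin pairdot.
Proof.
split=> k x y z; first exact: pairdot_linl.
by rewrite !(pairdotC z) pairdot_linl.
Qed.

Lemma pairdot_ge0 x : 0 <= pairdot x x.
Proof.
rewrite addr_ge0//; last by apply: form_tr_ge0 => X; exact: (dotg_ge0 thetaC).
rewrite mulr_ge0 ?invr_ge0 ?ler0n//.
by apply: form_tr_ge0 => X; apply: form_tr_ge0 => Y; exact: ip_ge0.
Qed.

Lemma pairdot_eq0 x : pairdot x x = 0 -> x = 0.
Proof.
have t1 : 0 <= form_tr ip (fun X X' => form_tr ip (fun Y Y' =>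
    ip (x.1 X Y) (x.1 X' Y'))).
  by apply: form_tr_ge0 => X; apply: form_tr_ge0 => Y; exact: ip_ge0.
have t2 : 0 <= form_tr ip (fun X X' => dotg (x.2 X) (x.2 X')).
  by apply: form_tr_ge0 => X; exact: (dotg_ge0 thetaC).
rewrite /pairdot => x0.
have {}t10 : form_tr ip (fun X X' => form_tr ip (fun Y Y' =>
    ip (x.1 X Y) (x.1 X' Y'))) = 0 by lra.
have {}t20 : form_tr ip (fun X X' => dotg (x.2 X) (x.2 X')) = 0 by lra.
case: x {x0 t1 t2} t10 t20 => mu phi /= t1 t2; congr (_, _); apply/lfunP => X.
  apply/lfunP => Y; rewrite !zero_lfunE; apply: (@ip_eq0 _ _ ip).
  have mu0 : forall X, form_tr ip (fun Y Y' => ip (mu X Y) (mu X Y')) = 0.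
    apply: (@form_tr_eq0 _ _ ip (fun X X' => form_tr ip (fun Y Y' =>
      ip (mu X Y) (mu X' Y')))) => //.
    - by apply: bilin_form_tr => Z; exact: (bilin_bracket1 (mu, phi) (mu, phi)).
    - by move=> Z W; apply: eq_form_tr => U; exact: ipC.
    - by move=> Z; apply: form_tr_ge0 => U; exact: ip_ge0.
  apply: (@form_tr_eq0 _ _ ip (fun Y Y' => ip (mu X Y) (mu X Y'))) => //.
  - exact: (bilin_bracket2 (mu, phi) (mu, phi)).
  - by move=> Z W; exact: ipC.
  - by move=> Z; exact: ip_ge0.
rewrite zero_lfunE; apply: (dotg_eq0 thetaC).
apply: (@form_tr_eq0 _ _ ip (fun X X' => dotg (phi X) (phi X'))) => //.
- by split=> k Y Z W; rewrite linearP (dotg_linl, dotg_linr thetaC).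
- by move=> Z W; exact: (dotgC thetaC).
- by move=> Z; exact: (dotg_ge0 thetaC).
Qed.

Lemma in_Vn_anti x X Y : in_Vn x -> x.1 X Y = - x.1 Y X.
Proof.
move=> alt; have := alt (X + Y).
rewrite !linearD /= !add_lfunE !alt add0r addr0 => /eqP.
by rewrite addrC addr_eq0 => /eqP.
Qed.

Lemma dot_pairsE x y : in_Vn x -> in_Vn y ->
  dot_pairs ad theta ip x y = pairdot x y.
Proof.
move=> xV yV; congr (_ + _); rewrite /form_tr.
set F := fun i j : 'I_(\dim {:V}) =>
  ip (x.1 (onb ip)`_i (onb ip)`_j) (y.1 (onb ip)`_i (onb ip)`_j).
have FC i j : F i j = F j i.
  by rewrite /F (in_Vn_anti _ _ xV) (in_Vn_anti _ _ yV) ipNl ipNr opprK.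
have F0 i : F i i = 0 by rewrite /F xV ip0l.
suff -> : \sum_(i < \dim {:V}) \sum_(j < \dim {:V}) F i j =
    2 * \sum_(i < \dim {:V}) \sum_(j < \dim {:V} | (i < j)%N) F i j.
  by rewrite mulKf ?pnatr_eq0.
transitivity (\sum_(i < \dim {:V}) \sum_(j < \dim {:V} | (i < j)%N) F i j +
              \sum_(i < \dim {:V}) \sum_(j < \dim {:V} | (j < i)%N) F i j).
  rewrite -big_split /=; apply: eq_bigr => i _.
  rewrite (bigID (fun j : 'I_(\dim {:V}) => (i < j)%N)) /=; congr (_ + _).
  rewrite (bigD1 i) ?ltnn//= F0 add0r; apply: eq_bigl => j.
  by rewrite -leqNgt -val_eqE /= ltn_neqAle andbC.
rewrite [X in _ + X](exchange_big_dep predT)//= mulr_natl mulr2n; congr (_ + _).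
by apply: eq_bigr => i _; apply: eq_bigr => j _; rewrite FC.
Qed.

(** The adjoint of an element for its action on pairs, see [pairdot_act]. *)
Definition gadj a : gc g V := (adjoint ip a.1, - theta a.2).

Lemma act_homE a x X : (act ad a x).2 X = ad a.2 (x.2 X) - x.2 (a.1 X).
Proof. by rewrite /= !lfunE_op. Qed.

Lemma act_linl k a b x : act ad (k *: a + b) x = k *: act ad a x + act ad b x.
Proof.
congr (_, _); apply/lfunP => X; last first.
  by rewrite /= !(lfunE_op, lfunE_lin) scale_add_sub.
apply/lfunP => Y; rewrite !lfunE_op !act_bracketE /=.
by rewrite !(lfunE_op, lfunE_lin) !scale_add_sub.
Qed.

Lemma act_linr k a x y : act ad a (k *: x + y) = k *: act ad a x + act ad a y.
Proof.
congr (_, _); apply/lfunP => X; last first.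
  by rewrite /= !(lfunE_op, lfunE_lin) scale_add_sub.
apply/lfunP => Y; rewrite !lfunE_op !act_bracketE /=.
by rewrite !(lfunE_op, lfunE_lin) !scale_add_sub.
Qed.

Lemma act0 a : act ad a 0 = 0.
Proof.
have := act_linr (-1) a 0 0.
by rewrite scaler0 addr0 scaleN1r addNr.
Qed.

Lemma act_in_Vn a x : in_Vn x -> in_Vn (act ad a x).
Proof.
move=> xV X; rewrite act_bracketE /= xV lfun0 sub0r.
by rewrite (in_Vn_anti _ _ xV) opprK subrr.
Qed.

Lemma act_id x : act ad (\1%VF, 0) x = - x.
Proof.
congr (_, _); apply/lfunP => X; last first.
  by rewrite /= !(lfunE_op, lfunE_lin) sub0r.
by apply/lfunP => Y; rewrite act_bracketE /= !lfunE_op subrr sub0r.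
Qed.

Definition gbr a b : gc g V :=
  ((a.1 \o b.1)%VF - (b.1 \o a.1)%VF, ad a.2 b.2).

Lemma act_gbr a b x :
  act ad (gbr a b) x = act ad a (act ad b x) - act ad b (act ad a x).
Proof.
congr (_, _); apply/lfunP => X; last first.
  by rewrite /= !(lfunE_op, lfunE_lin) (br_jacobi adL); dotg_ring thetaC.
apply/lfunP => Y; rewrite !lfunE_op !act_bracketE /=.
rewrite !(act_bracketE, lfunE_op, lfunE_lin).
by ip_ring ip.
Qed.

(** Each term of the action is moved to the other side by [form_tr_shift] or
   [dotg_ad]. *)
Lemma pairdot_act a x y :
  pairdot (act ad a x) y = pairdot x (act ad (gadj a) y).
Proof.
case: a => A v; case: x => mu phi; case: y => nu psi.
have E2 : form_tr ip (fun X X' =>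
      dotg ((ad v \o phi)%VF X - (phi \o A)%VF X) (psi X')) =
    form_tr ip (fun X X' =>
      dotg (phi X) ((ad (- theta v) \o psi)%VF X' - (psi \o adjoint ip A)%VF X')).
  transitivity (form_tr ip (fun X X' => dotg (phi X) (ad (- theta v) (psi X'))) -
      form_tr ip (fun X X' => dotg (phi (A X)) (psi X'))).
    rewrite -form_trB; apply: eq_form_tr => X.
    by rewrite !comp_lfunE (dotgDl thetaC) (dotgNl thetaC) (dotg_ad adL thetaC).
  rewrite (@form_tr_shift _ _ ip (fun X X' => dotg (phi X) (psi X'))).
    rewrite -form_trB; apply: eq_form_tr => X.
    by rewrite !comp_lfunE (dotgDr thetaC) (dotgNr thetaC).
  by split=> k X Y Z; rewrite lfunL (dotg_linl, dotg_linr thetaC).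
have E1 : form_tr ip (fun X X' => form_tr ip (fun Y Y' =>
      ip (act_bracket A mu X Y) (nu X' Y'))) =
    form_tr ip (fun X X' => form_tr ip (fun Y Y' =>
      ip (mu X Y) (act_bracket (adjoint ip A) nu X' Y'))).
  transitivity (form_tr ip (fun X X' => form_tr ip (fun Y Y' =>
        ip (mu X Y) (adjoint ip A (nu X' Y')))) -
      form_tr ip (fun X X' => form_tr ip (fun Y Y' =>
        ip (mu (A X) Y) (nu X' Y'))) -
      form_tr ip (fun X X' => form_tr ip (fun Y Y' =>
        ip (mu X (A Y)) (nu X' Y')))).
    rewrite -!form_trB; apply: eq_form_tr => X.
    rewrite -!form_trB; apply: eq_form_tr => Y.
    by rewrite act_bracketE !ipBl adjointP.
  rewrite (@form_tr_shift _ _ ip (fun X X' => form_tr ip (fun Y Y' =>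
        ip (mu X Y) (nu X' Y')))); last first.
    by apply: bilin_form_tr => Y; apply: (@bilin_bracket1 (mu, phi) (nu, psi)).
  rewrite -!form_trB; apply: eq_form_tr => X.
  rewrite (@form_tr_shift _ _ ip (fun Y Y' => ip (mu X Y) (nu X Y'))); last first.
    exact: (@bilin_bracket2 (mu, phi) (nu, psi)).
  rewrite -!form_trB; apply: eq_form_tr => Y.
  by rewrite act_bracketE !ipBr.
rewrite /pairdot /= E1; apply: f_equal.
transitivity (form_tr ip (fun X X' =>
      dotg ((ad v \o phi)%VF X - (phi \o A)%VF X) (psi X'))).
  by apply: eq_form_tr => X; rewrite !lfunE_op.
by rewrite E2; apply: eq_form_tr => X; rewrite !lfunE_op.
Qed.

End PairForms.

(** * The moment and the critical pairs *)

Section Moment.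
Variables (R : realType) (g V : vectType R).
Variables (ad : 'Hom(g, 'End(g))) (theta : 'End(g)).
Variable ip : {dot V for (@idfun R)}.
Hypotheses (adL : lie_bracket ad) (thetaC : cartan_involution ad theta).
Implicit Types (x y z w : pairs g V) (a b c : gc g V) (X Y Z : V).

Local Notation dotg := (dot_g ad theta).
Local Notation gcdot := (dot_gc ad theta ip).
Local Notation pdot := (pairdot ad theta ip).
Local Notation adj := (gadj theta ip).

Lemma gcdotE a b :
  gcdot a b = lfun_tr (a.1 \o adjoint ip b.1)%VF + dotg a.2 b.2.
Proof. by []. Qed.

Lemma gcdotC a b : gcdot a b = gcdot b a.
Proof.
rewrite !gcdotE (dotgC thetaC) -(lfun_tr_adjoint ip) adjoint_comp adjointK.
by [].
Qed.

Lemma gcdot_linl k a b c : gcdot (k *: a + b) c = k * gcdot a c + gcdot b c.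
Proof.
rewrite !gcdotE /= dotg_linl comp_lfunDl -comp_lfunZl lfun_trD lfun_trZ; ring.
Qed.

Lemma gcdot_bilin : bilin gcdot.
Proof.
split=> k a b c; first exact: gcdot_linl.
by rewrite !(gcdotC c) gcdot_linl.
Qed.

Lemma gcdotDl a b c : gcdot (a + b) c = gcdot a c + gcdot b c.
Proof. exact: bilinDl gcdot_bilin. Qed.

Lemma gcdotDr a b c : gcdot c (a + b) = gcdot c a + gcdot c b.
Proof. exact: bilinDr gcdot_bilin. Qed.

Lemma gcdotZl k a b : gcdot (k *: a) b = k * gcdot a b.
Proof.
by rewrite -[k *: a]addr0 gcdot_linl (bilin0l _ gcdot_bilin) addr0.
Qed.

Lemma gcdotZr k a b : gcdot b (k *: a) = k * gcdot b a.
Proof. by rewrite !(gcdotC b) gcdotZl. Qed.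

Lemma gcdotNl a b : gcdot (- a) b = - gcdot a b.
Proof. by rewrite -scaleN1r gcdotZl mulN1r. Qed.

Lemma gcdot_ge0 a : 0 <= gcdot a a.
Proof. by rewrite gcdotE addr_ge0 ?lfun_tr_ge0// (dotg_ge0 thetaC). Qed.

Lemma gcdot_eq0 a : gcdot a a = 0 -> a = 0.
Proof.
have := lfun_tr_ge0 ip a.1; have := dotg_ge0 thetaC a.2; rewrite gcdotE => h1 h2 h.
case: a h1 h2 h => A v /= h1 h2 h; congr (_, _).
  by apply: (@lfun_tr_eq0 _ _ ip); lra.
by apply: (dotg_eq0 thetaC); lra.
Qed.

Lemma gcdot_extl a b : (forall c, gcdot a c = gcdot b c) -> a = b.
Proof.
move=> E; apply/eqP; rewrite -subr_eq0; apply/eqP/gcdot_eq0.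
by rewrite gcdotDl gcdotNl E subrr.
Qed.

Lemma gcdot_gadj a b : gcdot a (adj b) = gcdot (adj a) b.
Proof.
have [inv _ _] := thetaC.
rewrite !gcdotE /= adjointK -adjoint_comp lfun_tr_adjoint; congr (_ + _).
  by rewrite lfun_trC.
rewrite (dotgNr thetaC) (dotgNl thetaC) /dot_g inv killing_theta//.
Qed.

Lemma moment_exists x : in_Vn x ->
  exists m, forall a, gcdot m a = pdot (act ad a x) x.
Proof.
move=> xV; apply: riesz; [exact: gcdot_bilin|exact: gcdot_eq0|].
by move=> k a b; rewrite act_linl pairdot_linl.
Qed.

Lemma momentP x a : in_Vn x ->
  gcdot (moment ad theta ip x) a = pdot (act ad a x) x.
Proof.
move=> xV; have [m mP] := moment_exists xV.
have ex : exists m, forall a, gcdot m a = dot_pairs ad theta ip (act ad a x) x.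
  by exists m => b; rewrite mP dot_pairsE//; apply: act_in_Vn.
have := @xgetPex _ 0 [set m : gc g V | forall a, gcdot m a =
  dot_pairs ad theta ip (act ad a x) x]%classic ex.
move=> /(_ a); rewrite dot_pairsE//; exact: act_in_Vn.
Qed.

Lemma moment_uniq x m : in_Vn x ->
  (forall a, gcdot m a = pdot (act ad a x) x) -> moment ad theta ip x = m.
Proof. by move=> xV mP; apply: gcdot_extl => a; rewrite momentP// mP. Qed.

(** Both sides have the same product with every a, since <a x, x> = <a^* x, x>. *)
Lemma moment_gadj x : in_Vn x ->
  adj (moment ad theta ip x) = moment ad theta ip x.
Proof.
move=> xV; apply: gcdot_extl => a; rewrite -gcdot_gadj !momentP//.
by rewrite [RHS](pairdot_act ip adL thetaC) (pairdotC ip thetaC).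
Qed.

Lemma moment_selfadj x : in_Vn x -> selfadj ip (moment ad theta ip x).1.
Proof.
move=> xV X Y; rewrite adjointP.
by have /= -> := congr1 fst (moment_gadj xV).
Qed.

End Moment.

Section Critical.
Variables (R : realType) (g V : vectType R).
Variables (ad : 'Hom(g, 'End(g))) (theta : 'End(g)).
Variable ip : {dot V for (@idfun R)}.
Hypotheses (adL : lie_bracket ad) (thetaC : cartan_involution ad theta).
Implicit Types (x y z w : pairs g V) (a b c : gc g V) (X Y Z : V).

Local Notation gcdot := (dot_gc ad theta ip).
Local Notation pdot := (pairdot ad theta ip).
Local Notation M := (moment ad theta ip).

Lemma in_Ln_Vn x : in_Ln ad x -> in_Vn x.
Proof. by case=> -[]. Qed.

Lemma is_derive_ratio (P Q : {poly R}) : Q.[0] != 0 ->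
  is_derive (0 : R) (1 : R) (fun t => P.[t] / Q.[t] ^+ 2)
    (((poly.deriv P).[0] * Q.[0] - 2 * P.[0] * (poly.deriv Q).[0]) / Q.[0] ^+ 3).
Proof.
move=> Q0.
have dP := is_derive_poly P 0.
have dQ := is_derive_poly (Q ^+ 2) 0.
have Q20 : (Q ^+ 2).[0] != 0 by rewrite horner_exp expf_neq0.
have dV := is_deriveV Q20 dQ.
have dM := is_deriveM dP dV.
have -> : (fun t => P.[t] / Q.[t] ^+ 2) =
    horner P * (fun t => ((Q ^+ 2).[t])^-1).
  by apply/funext => t; rewrite fctE horner_exp.
apply: (is_derive_eq dM).
rewrite !horner_exp expr2 derivM !hornerE /= /GRing.scale /=; field.
by [].
Qed.

Lemma pdotDl x y z : pdot (x + y) z = pdot x z + pdot y z.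
Proof. exact: bilinDl (pairdot_bilin ip thetaC). Qed.
Lemma pdotDr x y z : pdot z (x + y) = pdot z x + pdot z y.
Proof. exact: bilinDr (pairdot_bilin ip thetaC). Qed.
Lemma pdotZl k x y : pdot (k *: x) y = k * pdot x y.
Proof.
have pb := pairdot_bilin ip thetaC.
by rewrite -[k *: x]addr0 pb.1 (bilin0l _ pb) addr0.
Qed.
Lemma pdotZr k x y : pdot y (k *: x) = k * pdot y x.
Proof. by rewrite !(pairdotC _ thetaC y) pdotZl. Qed.
Lemma pdotNl x y : pdot (- x) y = - pdot x y.
Proof. by rewrite -scaleN1r pdotZl mulN1r. Qed.

(** The moment is quadratic, so M (x + t w) = M x + t N + t^2 M w where N is its
   polarization, and the energy is a ratio of polynomials in t.  The linear
   coefficient of |M (x + t w)|^2 is 2 <M x, N> = 4 <(M x) x, w>. *)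
Lemma energy_derive x w : in_Vn x -> in_Vn w -> x != 0 ->
  is_derive (0 : R) (1 : R) (fun t : R => energy ad theta ip (x + t *: w))
    (4 / pdot x x ^+ 2 * pdot (act ad (Du ad theta ip x) x) w).
Proof.
move=> xV wV x0.
have pV t : in_Vn (x + t *: w).
  by move=> X; rewrite /= !lfunE_op xV wV scaler0 addr0.
have pxx : pdot x x != 0.
  by apply/eqP => /(pairdot_eq0 thetaC)/eqP; rewrite (negPf x0).
have actD a u v : act ad a (u + v) = act ad a u + act ad a v.
  by rewrite -{1}[u]scale1r act_linr// scale1r.
have actZ a k u : act ad a (k *: u) = k *: act ad a u.
  have := act_linr ad k a u 0; rewrite !addr0 => ->.
  by rewrite act0 addr0.
have [N NP] : exists N, forall a,
    gcdot N a = pdot (act ad a x) w + pdot (act ad a w) x.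
  apply: riesz; [exact: gcdot_bilin|exact: gcdot_eq0|] => k a b.
  by rewrite !act_linl !pairdot_linl; ring.
have NM : gcdot (M x) N = 2 * pdot (act ad (M x) x) w.
  rewrite (gcdotC ip thetaC) NP (pairdot_act ip adL thetaC _ w) moment_gadj//.
  by rewrite (pairdotC ip thetaC w); ring.
have Mt t : M (x + t *: w) = M x + t *: N + t ^+ 2 *: M w.
  apply: moment_uniq => // a; rewrite !gcdotDl// !gcdotZl// NP !momentP//.
  by rewrite actD actZ !pdotDl !pdotDr !pdotZl !pdotZr; ring.
pose P : {poly R} := (gcdot (M x) (M x))%:P + (2 * gcdot (M x) N) *: 'X +
  (gcdot N N + 2 * gcdot (M x) (M w)) *: 'X^2 + (2 * gcdot N (M w)) *: 'X^3 +
  (gcdot (M w) (M w)) *: 'X^4.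
pose Q : {poly R} := (pdot x x)%:P + (2 * pdot x w) *: 'X + pdot w w *: 'X^2.
have -> : (fun t : R => energy ad theta ip (x + t *: w)) =
    (fun t => P.[t] / Q.[t] ^+ 2).
  apply/funext => t; rewrite /energy dot_pairsE// Mt.
  rewrite !(gcdotDl, gcdotDr, gcdotZl, gcdotZr)// !(pdotDl, pdotDr, pdotZl, pdotZr).
  rewrite (gcdotC ip thetaC N (M x)) (gcdotC ip thetaC (M w) (M x)).
  rewrite (gcdotC ip thetaC (M w) N) (pairdotC ip thetaC w x) /P /Q !hornerE.
  by rewrite /=; congr (_ / _ ^+ 2); ring.
have Q0 : Q.[0] = pdot x x by rewrite /Q !hornerE /=; ring.
have P0 : P.[0] = gcdot (M x) (M x) by rewrite /P !hornerE /=; ring.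
have Q1 : (poly.deriv Q).[0] = 2 * pdot x w.
  by rewrite /Q !poly.derivE !hornerE /=; ring.
have P1 : (poly.deriv P).[0] = 2 * gcdot (M x) N.
  by rewrite /P !poly.derivE !hornerE /=; ring.
have Q0n : Q.[0] != 0 by rewrite Q0.
apply: (is_derive_eq (is_derive_ratio P Q0n)).
rewrite Q0 P0 Q1 P1 NM /Du [moment _ _ _ _ + _]addrC act_linl act_id.
by rewrite pdotDl pdotZl pdotNl /kappa dot_pairsE//; field.
Qed.

(** The vector (Du x) x is itself alternating, hence an admissible direction. *)
Lemma criticalP x : in_Ln ad x -> x != 0 ->
  critical ad theta ip x <-> act ad (Du ad theta ip x) x = 0.
Proof.
move=> xL x0; have xV := in_Ln_Vn xL.
have pxx : pdot x x != 0.
  by apply/eqP => /(pairdot_eq0 thetaC)/eqP; rewrite (negPf x0).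
have c0 : 4 / pdot x x ^+ 2 != 0.
  by rewrite mulf_neq0 ?invr_neq0 ?expf_neq0 ?pnatr_eq0.
split=> [[_ _ crit]|Dx].
  apply: (pairdot_eq0 thetaC (ip := ip)).
  have wV : in_Vn (act ad (Du ad theta ip x) x) by exact: act_in_Vn.
  have [_ d1] := crit _ wV; have [_ d2] := energy_derive xV wV x0.
  by move: d2; rewrite d1 => /esym/eqP; rewrite mulf_eq0 (negPf c0) => /eqP.
split=> // w wV; apply: (is_derive_eq (energy_derive xV wV x0)).
by rewrite Dx (bilin0l _ (pairdot_bilin ip thetaC)) mulr0.
Qed.

End Critical.

(** * Derivations of a critical pair *)

Section CriticalPair.
Variables (R : realType) (g V : vectType R).
Variables (ad : 'Hom(g, 'End(g))) (theta : 'End(g)).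
Variable ip : {dot V for (@idfun R)}.
Hypotheses (adL : lie_bracket ad) (thetaC : cartan_involution ad theta).
Implicit Types (a b c : gc g V) (X Y Z : V).

Local Notation dotg := (dot_g ad theta).
Local Notation gcdot := (dot_gc ad theta ip).
Local Notation pdot := (pairdot ad theta ip).
Local Notation adj := (gadj theta ip).
Local Notation gbr := (gbr ad).

Lemma gadjK a : adj (adj a) = a.
Proof.
have [inv _ _] := thetaC.
by case: a => A v; rewrite /gadj /= adjointK lfunN inv opprK.
Qed.

(** The bracket with a has the bracket with the adjoint of a as its adjoint. *)
Lemma gcdot_gbr a b c : gcdot (gbr c a) b = gcdot c (gbr b (adj a)).
Proof.
rewrite !gcdotE /=; congr (_ + _).
  have -> : adjoint ip ((b.1 \o adjoint ip a.1)%VF - (adjoint ip a.1 \o b.1)%VF) =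
      (a.1 \o adjoint ip b.1)%VF - (adjoint ip b.1 \o a.1)%VF.
    apply: adjoint_uniq => X Y.
    rewrite !lfunE_op ipBl ipBr (adjointP ip b.1) -!(adjointPr ip a.1).
    by rewrite (adjointP ip b.1).
  rewrite comp_lfunDl comp_lfunDr comp_lfunNl comp_lfunNr !lfun_trB.
  by rewrite -!comp_lfunA [in X in _ - X]lfun_trC -!comp_lfunA.
rewrite (br_anti adL) (dotgNl thetaC) (dotg_ad adL thetaC) -(dotgNr thetaC).
by rewrite -(br_anti adL).
Qed.

Variables (mu : 'Hom(V, 'End(V))) (phi : 'Hom(V, g)).
Local Notation x := ((mu, phi) : pairs g V).
Hypotheses (xL : in_Ln ad x) (Dx : act ad (Du ad theta ip x) x = 0).

Local Notation D := (Du ad theta ip x).1.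
Local Notation u := (Du ad theta ip x).2.

(** The element of der x given by the inner derivation of X. *)
Definition inner X : gc g V := (mu X, phi X).

Let muL : lie_bracket mu. Proof. by case: xL. Qed.
Let phiM X Y : phi (mu X Y) = ad (phi X) (phi Y). Proof. by case: xL. Qed.
Let xV : in_Vn x. Proof. exact: in_Ln_Vn xL. Qed.

Lemma act_inner X : act ad (inner X) x = 0.
Proof.
congr (_, _); apply/lfunP => Y; last by rewrite /= !lfunE_op phiM subrr.
apply/lfunP => Z; rewrite act_bracketE /= !lfunE_op (br_jacobi muL).
by rewrite subKr subrr.
Qed.

Lemma der_bracket a X Y : act ad a x = 0 ->
  a.1 (mu X Y) = mu (a.1 X) Y + mu X (a.1 Y).
Proof.
move=> /(congr1 fst) /= /lfunP/(_ X)/lfunP/(_ Y).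
rewrite act_bracketE !lfunE_op => /eqP.
by rewrite -addrA -opprD subr_eq0 => /eqP.
Qed.

Lemma der_hom a X : act ad a x = 0 -> ad a.2 (phi X) = phi (a.1 X).
Proof.
move=> /(congr1 snd) /= /lfunP/(_ X); rewrite !lfunE_op => /eqP.
by rewrite subr_eq0 => /eqP.
Qed.

Lemma gbr_inner a X : act ad a x = 0 -> gbr a (inner X) = inner (a.1 X).
Proof.
move=> ax; rewrite /inner -(der_hom _ ax); congr (_, _).
apply/lfunP => Y; rewrite !lfunE_op (der_bracket _ _ ax).
by rewrite addrK.
Qed.

Lemma inner_linear k X Y : inner (k *: X + Y) = k *: inner X + inner Y.
Proof. by rewrite /inner !lfunL. Qed.

(** Since a x = 0, |a^* x|^2 = <a a^* x, x> = <[a, a^*] x, x> = <M, [a, a^*]>.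
   Replacing M by Du x costs nothing, because the trace of a commutator is 0, and
   the bracket is moved to the other side by [gcdot_gbr]. *)
Lemma norm_act_gadj a : act ad a x = 0 ->
  pdot (act ad (adj a) x) (act ad (adj a) x) = gcdot (gbr (Du ad theta ip x) a) a.
Proof.
move=> ax; rewrite (pairdot_act ip adL thetaC) gadjK (pairdotC ip thetaC).
have -> : act ad a (act ad (adj a) x) = act ad (gbr a (adj a)) x.
  by rewrite (act_gbr ip adL thetaC) ax act0 subr0.
rewrite -(momentP ip thetaC _ xV) gcdot_gbr /Du gcdotDl// gcdotZl//.
rewrite [X in _ = _ + _ * X](_ : _ = 0) ?mulr0 ?addr0// gcdotE /=.
rewrite (dotg0l thetaC) addr0 comp_lfun1l lfun_tr_adjoint lfun_trB.
by rewrite lfun_trC subrr.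
Qed.

Lemma Du_selfadj : selfadj ip D.
Proof.
move=> X Y; rewrite /= !lfunE_op ipDl ipDr ipZl ipZr.
by rewrite (moment_selfadj ip adL thetaC xV).
Qed.

Lemma kappa_ge0 : 0 <= kappa ad theta ip x.
Proof.
rewrite divr_ge0 ?gcdot_ge0// dot_pairsE// pairdot_ge0//.
Qed.

(** By [norm_act_gadj], l |inner X|^2 >= 0.  If l < 0, then inner X = 0: X is
   central and killed by phi.  The moment then sees X only as a component of
   values of the bracket, so <M X, X> >= 0 and l |X|^2 = <D X, X> >= k |X|^2 >= 0. *)
Lemma Du_eigen_ge0 X l : D X = l *: X -> X != 0 -> 0 <= l.
Proof.
move=> DX X0; rewrite leNgt; apply/negP => l0.
have XX : 0 < ip X X by exact: ip_gt0.
have iX : inner X = 0.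
  apply: (gcdot_eq0 (ad := ad) (theta := theta) (ip := ip) thetaC).
  have := pairdot_ge0 ip thetaC (act ad (adj (inner X)) x).
  rewrite norm_act_gadj ?act_inner// gbr_inner// DX.
  rewrite -[l *: X]addr0 inner_linear [inner 0](_ : _ = 0) ?addr0; last first.
    by rewrite /inner !lfun0.
  have := gcdot_ge0 ip thetaC (inner X); rewrite gcdotZl//.
  by rewrite nmulr_rge0// => h1 h2; apply/eqP; rewrite eq_le h1 h2.
have [muX phiX] : mu X = 0 /\ phi X = 0 by case: iX.
(* Testing the moment on the rank one operator Y |-> <Y, X> X. *)
pose fA Y := ip Y X *: X.
have fAl : linear fA.
  by move=> c Y Z; rewrite /fA ip_linl scalerDl scalerA.
pose A := linfun fA; have AE Y : A Y = ip Y X *: X by rewrite /A linfun_ext.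
have MX : 0 <= ip ((moment ad theta ip x).1 X) X.
  have := momentP ip thetaC ((A, 0) : gc g V) xV.
  rewrite gcdotE /= (dotgC thetaC) (dotg0l thetaC) addr0.
  rewrite (adjoint_selfadj (A := A)); last first.
    by move=> Y Z; rewrite !AE ipZl ipZr (ipC ip Z X) mulrC.
  rewrite (lfun_trE ip).
  rewrite (_ : form_tr ip _ = ip ((moment ad theta ip x).1 X) X); last first.
    rewrite [RHS](parseval ip); apply: eq_bigr => i _.
    by rewrite comp_lfunE AE lfunZ ipZl mulrC (ipC ip X).
  move=> ->; rewrite /pairdot /= addr_ge0//; last first.
    apply: form_tr_ge0 => Y; rewrite !lfunE_op lfun0 zero_lfunE AE lfunZ phiX.
    by rewrite scaler0 subr0 (dotg0l thetaC).
  rewrite mulr_ge0 ?invr_ge0 ?ler0n//; apply: form_tr_ge0 => Y.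
  apply: form_tr_ge0 => Z; rewrite act_bracketE !AE !lfunZ scale_lfunE muX.
  rewrite zero_lfunE (br_anti muL Y X) muX zero_lfunE oppr0 !scaler0 !subr0.
  by rewrite ipZl (ipC ip X) -expr2 sqr_ge0.
have : ip (D X) X < 0 by rewrite DX ipZl nmulr_rlt0.
rewrite /= !lfunE_op ipDl ipZl ltNge addr_ge0// mulr_ge0 ?kappa_ge0//.
exact: ltW.
Qed.

(** By [norm_act_gadj] again, ker D is where the adjoint of inner X stays in
   der x. *)
Section KernelOfD.
Variable X : V.
Hypothesis DX0 : D X = 0.

Lemma ker_act_gadj : act ad (adj (inner X)) x = 0.
Proof.
apply: (pairdot_eq0 thetaC (ip := ip)).
rewrite norm_act_gadj ?act_inner// gbr_inner// DX0.
rewrite (_ : inner 0 = 0); last by rewrite /inner !lfun0.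
exact: bilin0l (gcdot_bilin ip thetaC).
Qed.

Lemma ker_adjoint_der Y Z : adjoint ip (mu X) (mu Y Z) =
  mu (adjoint ip (mu X) Y) Z + mu Y (adjoint ip (mu X) Z).
Proof. exact: (der_bracket _ _ ker_act_gadj). Qed.

Lemma ker_adjoint_hom Y : ad (- theta (phi X)) (phi Y) = phi (adjoint ip (mu X) Y).
Proof. exact: (der_hom _ ker_act_gadj). Qed.

End KernelOfD.

End CriticalPair.

(** * Solvable and nilpotent ideals *)

Section Brv.
Variables (K : fieldType) (V : vectType K) (br : 'Hom(V, 'End(V))).
Implicit Types (U W I J : {vspace V}).

Lemma mem_brv U W x y : x \in U -> y \in W -> br x y \in brv br U W.
Proof.
move=> xU yW; rewrite (coord_vbasis xU) linear_sum sum_lfunE /=.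
apply: memv_suml => i _; rewrite lfunZ scale_lfunE memvZ//.
rewrite (coord_vbasis yW) linear_sum /=; apply: memv_suml => j _.
rewrite lfunZ memvZ// memv_span//; apply/allpairsP.
by exists ((vbasis U)`_i, (vbasis W)`_j); split; rewrite // mem_nth ?size_tuple.
Qed.

Lemma brv_subP U W J :
  (forall x y, x \in U -> y \in W -> br x y \in J) -> (brv br U W <= J)%VS.
Proof.
move=> H; apply/span_subvP => _ /allpairsP[[x y] /= [xU yW ->]].
by apply: H; exact: vbasis_mem.
Qed.

Lemma brvS U W U' W' : (U <= U')%VS -> (W <= W')%VS ->
  (brv br U W <= brv br U' W')%VS.
Proof.
by move=> /subvP UU /subvP WW; apply: brv_subP => x y xU yW; rewrite mem_brv ?UU ?WW.
Qed.

Lemma derivedS k I J : (I <= J)%VS ->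
  (iter k (fun W => brv br W W) I <= iter k (fun W => brv br W W) J)%VS.
Proof. by move=> IJ; elim: k => //= k IH; apply: brvS. Qed.

Lemma nilpotent_solvable I : (forall x y, x \in I -> y \in I -> br x y \in I) ->
  nilpotent_sub br I -> solvable_sub br I.
Proof.
move=> Isub [k Ik]; exists k; apply/eqP; rewrite -subv0 -Ik {Ik}.
suff : (iter k (fun W => brv br W W) I <= iter k (fun W => brv br I W) I)%VS /\
    (iter k (fun W => brv br W W) I <= I)%VS by case.
elim: k => [|k [IH1 IH2]] //=; split; first exact: brvS.
apply: brv_subP => x y /(subvP IH2) xI /(subvP IH2) yI; exact: Isub.
Qed.

End Brv.

Section NormalNilpotent.
Variables (R : realType) (V : vectType R) (ip : {dot V for (@idfun R)}).

(** For a normal operator, N (N w) = 0 gives |N^* N w| = |N N w| = 0, hence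
   N w = 0. *)
Lemma normal_nilpotent (N : 'End(V)) k :
  (N \o adjoint ip N = adjoint ip N \o N)%VF ->
  (forall v, iter k N v = 0) -> N = 0.
Proof.
move=> nN Nk; apply/lfunP => v; rewrite zero_lfunE.
have ker2 w : N (N w) = 0 -> N w = 0.
  move=> NNw; apply: (@ip_eq0 _ _ ip); rewrite adjointP.
  suff -> : adjoint ip N (N w) = 0 by rewrite ip0r.
  have /lfunP/(_ (N w)) := nN; rewrite !comp_lfunE NNw lfun0 => NNN.
  by apply: (@ip_eq0 _ _ ip); rewrite -adjointPr NNN ip0r.
have := Nk v; case: k {Nk} => [/= ->|k]; first exact: lfun0.
by elim: k => [//|k IH] /ker2.
Qed.

End NormalNilpotent.

(** * The grading defined by a symmetric derivation *)

Section Structure.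
Variables (R : realType) (V : vectType R) (ip : {dot V for (@idfun R)}).
Variables (br : 'Hom(V, 'End(V))) (D : 'End(V)).
Implicit Types (X Y Z W : V) (I J U : {vspace V}).
Hypotheses (brL : lie_bracket br) (Dsym : selfadj ip D).
Hypothesis Dder : forall X Y, D (br X Y) = br (D X) Y + br X (D Y).
Hypothesis Dge0 : forall X l, D X = l *: X -> X != 0 -> 0 <= l.
Hypothesis Kder : forall X, D X = 0 -> forall Y Z,
  adjoint ip (br X) (br Y Z) =
  br (adjoint ip (br X) Y) Z + br Y (adjoint ip (br X) Z).

Local Notation n := (\dim {:V}).
Local Notation adj := (adjoint ip).

Lemma eigen_decomposition : exists (e : n.-tuple V) (l : 'I_n -> R),
  [/\ orthonormal_basis ip e, forall i : 'I_n, D e`_i = l i *: e`_i &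
      forall i, 0 <= l i].
Proof.
have [e [oe De]] := spectral_basis Dsym.
have [l le] := @fin_all_exists _ _ (fun (i : 'I_n) l => D e`_i = l *: e`_i) De.
exists e, l; split=> // i; apply: (Dge0 (le i)); apply/eqP => ei0.
have /andP[_ oo] := oe; have := orthonormal_tupleE i i oo; rewrite eqxx.
by rewrite ei0 ip0l => /esym/eqP; rewrite oner_eq0.
Qed.

Section Filtration.
Variables (e : n.-tuple V) (l : 'I_n -> R).
Hypotheses (oe : orthonormal_basis ip e) (De : forall i : 'I_n, D e`_i = l i *: e`_i).
Hypothesis l0 : forall i, 0 <= l i.

(** The span of the eigenvectors of eigenvalue at least t, as a predicate. *)
Definition filt t X := forall i : 'I_n, l i < t -> ip X e`_i = 0.

Lemma filtD t X Y : filt t X -> filt t Y -> filt t (X + Y).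
Proof. by move=> FX FY i it; rewrite ipDl FX// FY// addr0. Qed.

Lemma filtL t c X Y : filt t X -> filt t Y -> filt t (c *: X + Y).
Proof. by move=> FX FY i it; rewrite ip_linl FX// FY// mulr0 addr0. Qed.

Lemma filt_zero t : filt t 0. Proof. by move=> i _; rewrite ip0l. Qed.

Lemma filt_ge0 X : filt 0 X.
Proof. by move=> i; rewrite ltNge l0. Qed.

(** The bracket of two eigenvectors is an eigenvector for the sum of the
   eigenvalues, and eigenvectors of distinct eigenvalues are orthogonal. *)
Lemma filt_br s t X Y : filt s X -> filt t Y -> filt (s + t) (br X Y).
Proof.
move=> FX FY k kst; rewrite [X](onbasis_sum _ oe) [Y](onbasis_sum _ oe).
have bb : bilin (fun X Y => ip (br X Y) e`_k).
  by split=> a Z W T; [rewrite lfun2_linl|rewrite lfunL]; rewrite ip_linl.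
rewrite (bilin_suml _ _ _ bb) big1// => i _.
have [/FX->|si] := ltP (l i) s; first by rewrite mul0r.
rewrite (bilin_sumr _ _ _ bb) big1 ?mulr0// => j _.
have [/FY->|tj] := ltP (l j) t; first by rewrite mul0r.
have : ip (D (br e`_i e`_j)) e`_k = ip (br e`_i e`_j) (D e`_k) by exact: Dsym.
rewrite Dder !De !lfunE_lin scale_lfunE -scalerDl ipZl ipZr => /eqP.
rewrite -subr_eq0 -mulrBl mulf_eq0 => /orP[/eqP E|/eqP->]; last by rewrite mulr0.
have := lt_le_trans kst (lerD si tj); lra.
Qed.

Variable c : R.
Hypotheses (c0 : 0 < c) (cl : forall i, 0 < l i -> c <= l i).

Lemma filt_limg X : X \in limg D <-> filt c X.
Proof.
split=> [/memv_imgP[Y _ ->] i ic|FX].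
  rewrite Dsym De ipZr; have := l0 i; rewrite le_eqVlt => /orP[/eqP <-|/cl].
    by rewrite mul0r.
  by rewrite leNgt ic.
rewrite [X](onbasis_sum _ oe); apply: memv_suml => i _.
have := l0 i; rewrite le_eqVlt => /orP[/eqP li|li].
  by rewrite FX ?scale0r ?mem0v// -li.
apply: memvZ; apply/memv_imgP; exists ((l i)^-1 *: e`_i); rewrite ?memvf//.
by rewrite lfunZ De scalerA mulVf ?scale1r// gt_eqF.
Qed.

Lemma filt_eigen s t X : s < t -> D X = s *: X -> filt t X -> X = 0.
Proof.
move=> st DX FX; apply: (@ip_eq0 _ _ ip).
rewrite {2}[X](onbasis_sum _ oe) ip_sumr big1// => i _; rewrite ipZr.
have [/FX->|ti] := ltP (l i) t; first by rewrite mul0r.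
have : ip (D X) e`_i = ip X (D e`_i) by exact: Dsym.
rewrite De DX ipZl ipZr => /eqP; rewrite -subr_eq0 -mulrBl mulf_eq0.
by case/orP => [/eqP|/eqP->]; [lra|rewrite mul0r].
Qed.

Lemma filt_big : exists k : nat, forall X, filt (k%:R * c) X -> X = 0.
Proof.
pose B := \sum_i l i; pose k := (Num.truncn (B / c)).+1.
have Bk : B < k%:R * c.
  by rewrite -ltr_pdivrMr// /k truncnS_gt.
exists k => X FX; rewrite [X](onbasis_sum _ oe) big1// => i _.
rewrite FX ?scale0r//; apply: le_lt_trans Bk.
by rewrite /B (bigD1 i)//= lerDl sumr_ge0.
Qed.

End Filtration.

Lemma filtration_exists : exists (e : n.-tuple V) (l : 'I_n -> R) c,
  [/\ orthonormal_basis ip e, forall i : 'I_n, D e`_i = l i *: e`_i,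
      forall i, 0 <= l i, 0 < c & forall i, 0 < l i -> c <= l i].
Proof.
have [e [l [oe De l0]]] := eigen_decomposition.
exists e, l, (\big[Order.min/1]_(i | 0 < l i) l i); split=> //.
  by apply/bigmin_gtP; split.
by move=> i li; apply: bigmin_le_cond.
Qed.

Lemma limg_ideal X Y : Y \in limg D -> br X Y \in limg D.
Proof.
have [e [l [c [oe De l0 c0 cl]]]] := filtration_exists.
rewrite !(filt_limg oe De l0 c0 cl) => FY.
by rewrite -[c]add0r; apply: (filt_br oe De) => //; apply: filt_ge0.
Qed.

(** This is the nilradical in the presence of derivations (ad X)^* for X in the
   kernel of D, see [nilradical_nrad]. *)
Definition nrad : {vspace V} := (limg D + lker br)%VS.

Lemma nrad_br X Y : Y \in nrad -> br X Y \in limg D.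
Proof.
move=> /memv_addP[Y1 Y1D [Y2]]; rewrite memv_ker => /eqP Y2z ->.
rewrite lfunD (br_anti brL X Y2) Y2z zero_lfunE subr0; exact: limg_ideal.
Qed.

(** Bracketing with im D raises the filtration by the least positive eigenvalue
   c, and the center contributes nothing. *)
Lemma nrad_nilpotent : nilpotent_sub br nrad.
Proof.
have [e [l [c [oe De l0 c0 cl]]]] := filtration_exists.
have [K FK] := filt_big oe l0 c0; exists K; apply/eqP; rewrite -subv0.
apply/subvP => X XK; rewrite memv0; apply/eqP/FK; move: X XK.
elim: K {FK} => [|k IH] X; first by rewrite mul0r => _; apply: filt_ge0.
pose U := (\bigcap_(i < n | l i < k.+1%:R * c) orthov ip <[e`_i]>)%VS.
have UP Z : Z \in U <-> filt e l (k.+1%:R * c) Z.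
  rewrite memvE; split=> [/subv_bigcapP ZU i /ZU|FZ].
    by rewrite -memvE mem_orthov1 => /eqP.
  by apply/subv_bigcapP => i li; rewrite -memvE mem_orthov1; apply/eqP/FZ.
move=> XW; apply/UP; move: X XW; apply/subvP/brv_subP => X Y XN /IH FY.
apply/UP; move: XN => /memv_addP[X1 X1D [X2]]; rewrite memv_ker => /eqP X2z ->.
rewrite linearD /= X2z addr0 -natr1 mulrDl mul1r addrC.
by apply: (filt_br oe De) => //; apply/(filt_limg oe De l0 c0 cl).
Qed.

(** br A preserves the eigenspaces of D while br N raises the eigenvalues, so
   iterates of br (A + N) and br A on an eigenvector have the same component
   of lowest eigenvalue. *)
Lemma graded_nilpotent A N : D A = 0 -> N \in limg D ->
  (exists k, forall v, iter k (br (A + N)) v = 0) ->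
  exists k, forall v, iter k (br A) v = 0.
Proof.
move=> DA ND [k ANk]; exists k => v.
have [e [l [c [oe De l0 c0 cl]]]] := filtration_exists.
have DbrA X s : D X = s *: X -> D (br A X) = s *: br A X.
  by move=> DX; rewrite Dder DA lfun0 zero_lfunE add0r DX lfunZ.
have main (i : 'I_n) : iter k (br A) e`_i = 0.
  have DAk : D (iter k (br A) e`_i) = l i *: iter k (br A) e`_i.
    by elim: (k) => [|m IH] /=; [exact: De|exact: DbrA].
  have lc : l i < l i + c by rewrite ltrDl.
  apply: (filt_eigen oe De lc) => //.
  suff [_] : filt e l (l i) (iter k (br A) e`_i) /\
      filt e l (l i + c) (iter k (br (A + N)) e`_i - iter k (br A) e`_i).
    rewrite ANk sub0r => F; rewrite -[iter k _ _]opprK -scaleN1r.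
    by rewrite -[_ *: _]addr0; apply: filtL => //; apply: filt_zero.
  elim: (k) => [|m [IH1 IH2]] /=.
    split; last by rewrite subrr; apply: filt_zero.
    move=> j lj; rewrite orthonormal_tupleE; last by case/andP: oe.
    by case: eqVneq lj => // ->; rewrite ltxx.
  split; first by rewrite -[l i]add0r; apply: (filt_br oe De) => //; apply: filt_ge0.
  set p := iter m _ _ in IH1 IH2 *; set q := iter m _ _ in IH1 IH2 *.
  have -> : br (A + N) q - br A p = br (A + N) (q - p) + br N p.
    by rewrite !(lfunE_lin, lfunE_op); ip_ring ip.
  apply: filtD.
    by rewrite -[l i + c]add0r; apply: (filt_br oe De) => //; apply: filt_ge0.
  by rewrite addrC; apply: (filt_br oe De) => //; apply/(filt_limg oe De l0 c0 cl).
rewrite [v](onbasis_sum _ oe).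
have iterL (F : 'End(V)) : linear (iter k F).
  by move=> a x y; elim: (k) => [|m IH] //=; rewrite IH lfunL.
rewrite -linfun_ext// linear_sum big1// => i _.
by rewrite /= lfunZ linfun_ext// main scaler0.
Qed.

End Structure.

Lemma directv3 (K : fieldType) (V : vectType K) (U1 U2 U3 : {vspace V}) :
  (U1 :&: U2 = 0)%VS -> ((U1 + U2) :&: U3 = 0)%VS -> directv (U1 + U2 + U3).
Proof.
move=> U12 U123.
by rewrite directv_addE /= directv_addE /= !directv_trivial /= U12 U123 !eqxx.
Qed.

(** * The reductive complement of the nilradical *)

Section Reductive.
Variables (R : realType) (V : vectType R) (ip : {dot V for (@idfun R)}).
Variables (br : 'Hom(V, 'End(V))) (D : 'End(V)).
Implicit Types (X Y Z W : V) (I J U : {vspace V}).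
Hypotheses (brL : lie_bracket br) (Dsym : selfadj ip D).
Hypothesis Dder : forall X Y, D (br X Y) = br (D X) Y + br X (D Y).
Hypothesis Dge0 : forall X l, D X = l *: X -> X != 0 -> 0 <= l.
Hypothesis Kder : forall X, D X = 0 -> forall Y Z,
  adjoint ip (br X) (br Y Z) =
  br (adjoint ip (br X) Y) Z + br Y (adjoint ip (br X) Z).

Local Notation adj := (adjoint ip).
Local Notation nn := (nrad br D).
Local Notation P := (oproj ip nn).
Local Notation Q := (coproj ip nn).

Definition redpart : {vspace V} := orthov ip nn.

Lemma memv_redpart X : X \in redpart <-> forall Y, Y \in nn -> ip X Y = 0.
Proof. by split=> [/mem_orthovP|H]; [|apply/mem_orthovP]. Qed.

Lemma redpart_ker X : X \in redpart -> D X = 0.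
Proof.
move=> /memv_redpart H; apply: (@ip_eq0 _ _ ip); rewrite Dsym H//.
by rewrite (subvP (addvSl _ _))// memv_img// memvf.
Qed.

Lemma coproj_redpart X : Q X \in redpart.
Proof. by apply/memv_redpart => Y; apply: ip_coproj. Qed.

Lemma coproj_redpart_id X : X \in redpart -> Q X = X.
Proof. by move=> /memv_redpart; apply: coproj_id. Qed.

Lemma coproj_nrad X : X \in nn -> Q X = 0.
Proof. by move=> Xn; rewrite coprojE oproj_id// subrr. Qed.

Lemma br_nrad X Y : Y \in nn -> br X Y \in nn.
Proof.
move=> Yn; apply: (subvP (addvSl _ _)).
exact: (nrad_br brL Dsym Dder Dge0 X Yn).
Qed.

Section KernelElement.
Variable X : V.
Hypothesis DX : D X = 0.

Lemma comm_adjoint Y : D (adj (br X) Y) = adj (br X) (D Y).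
Proof.
apply: (@ip_extl _ _ ip) => Z.
rewrite Dsym -!adjointPr Dsym Dder DX.
by rewrite lfun0 zero_lfunE add0r.
Qed.

(** For X in ker D the adjoint of br X is a derivation commuting with D: it
   preserves im D and the center. *)
Lemma adjoint_nrad Y : Y \in nn -> adj (br X) Y \in nn.
Proof.
move=> /memv_addP[Y1 /memv_imgP[W _ ->] [Y2]]; rewrite memv_ker => /eqP Y2z ->.
rewrite lfunD; apply: memv_add.
  by rewrite -comm_adjoint memv_img// memvf.
rewrite memv_ker; apply/eqP/lfunP => Z; rewrite zero_lfunE.
have := Kder DX Y2 Z; rewrite Y2z !zero_lfunE lfun0 addr0.
by move=> <-.
Qed.

Lemma br_redpart Y : Y \in redpart -> br X Y \in redpart.
Proof.
move=> /memv_redpart Yr; apply/memv_redpart => Z Zn.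
by rewrite adjointP Yr// adjoint_nrad.
Qed.

Lemma adjoint_redpart Y : Y \in redpart -> adj (br X) Y \in redpart.
Proof.
move=> /memv_redpart Yr; apply/memv_redpart => Z Zn.
by rewrite -adjointPr Yr// br_nrad.
Qed.

Lemma comm_coproj (A : 'End(V)) Y : (forall Z, Z \in nn -> A Z \in nn) ->
  (forall Z, Z \in redpart -> A Z \in redpart) -> A (Q Y) = Q (A Y).
Proof.
move=> An Ar; rewrite -[in RHS](oproj_coproj ip nn Y) !lfunD.
rewrite (coproj_nrad (An _ (memv_oproj _ _ _))) add0r.
by rewrite (coproj_redpart_id (Ar _ (coproj_redpart Y))).
Qed.

Lemma br_coproj Y : br X (Q Y) = Q (br X Y).
Proof. by apply: comm_coproj => Z; [apply: br_nrad|apply: br_redpart]. Qed.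

Lemma adjoint_coproj Y : adj (br X) (Q Y) = Q (adj (br X) Y).
Proof. by apply: comm_coproj => Z; [apply: adjoint_nrad|apply: adjoint_redpart]. Qed.

Lemma br_adjoint Y :
  br (adj (br X) Y) = (adj (br X) \o br Y)%VF - (br Y \o adj (br X))%VF.
Proof.
apply/lfunP => Z; rewrite !lfunE_op Kder//.
by rewrite addrK.
Qed.

End KernelElement.

(** The center of redpart; composing with the projection Q expresses that br X
   vanishes on redpart as the vanishing of one linear map. *)
Definition redcen : {vspace V} :=
  (redpart :&: lker (linfun (fun X => (br X \o Q)%VF)))%VS.

Lemma memv_redcen X :
  X \in redcen <-> X \in redpart /\ forall W, W \in redpart -> br X W = 0.
Proof.
have fl : linear (fun X => (br X \o Q)%VF).
  by move=> c Y Z; apply/lfunP => W; rewrite !lfunE_op lfun2_linl.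
rewrite memv_cap memv_ker linfun_ext//; split=> [/andP[Xr /eqP XQ]|[Xr XQ]].
  split=> // W Wr; move/lfunP/(_ W): XQ.
  by rewrite comp_lfunE zero_lfunE coproj_redpart_id.
rewrite Xr; apply/eqP/lfunP => W; rewrite comp_lfunE zero_lfunE XQ//.
exact: coproj_redpart.
Qed.

Lemma adjoint_redcen X A : X \in redpart -> A \in redcen ->
  adj (br X) A \in redcen.
Proof.
move=> Xr /memv_redcen[Ar AW]; have DX := redpart_ker Xr.
apply/memv_redcen; split=> [|W Wr]; first exact: adjoint_redpart.
have := Kder DX A W; rewrite (AW W Wr) lfun0 (AW (adj _ W)) ?addr0//.
exact: adjoint_redpart.
Qed.

(** Modulo the center, Y may be taken orthogonal to redcen, which the adjoint of
   br X preserves. *)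
Lemma br_redcen_orth X Y A : X \in redpart -> Y \in redpart -> A \in redcen ->
  ip (br X Y) A = 0.
Proof.
move=> Xr Yr Ac; pose C := oproj ip redcen Y.
have Cc : C \in redcen by exact: memv_oproj.
have [Cr CW] : C \in redpart /\
    forall W, W \in redpart -> br C W = 0 by exact/memv_redcen.
have -> : br X Y = br X (coproj ip redcen Y).
  by rewrite coprojE lfunD lfunN -/C (br_anti brL X C) CW// oppr0 subr0.
by rewrite adjointP ip_coproj// adjoint_redcen.
Qed.

Lemma redcen_br_eq0 X Y : X \in redpart -> Y \in redpart ->
  br X Y \in redcen -> br X Y = 0.
Proof. by move=> Xr Yr XY; apply: (@ip_eq0 _ _ ip); apply: br_redcen_orth. Qed.

(** On redpart, the Killing form vanishes between an abelian ideal I and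
   everything ([killI] below).  Pair Y in I with W = (br Z)^* X, where
   Z = [X, Y]: as (br Z)^* is a derivation, br W is the commutator of (br Z)^* and
   br X, and the trace becomes that of br Z (br Z)^*, the square norm of br Z.
   So [redpart, I] is central, hence zero by [redcen_br_eq0]. *)
Lemma abelian_ideal_central I : (I <= redpart)%VS ->
  (forall X Y, X \in redpart -> Y \in I -> br X Y \in I) ->
  (forall X Y, X \in I -> Y \in I -> br X Y = 0) -> (I <= redcen)%VS.
Proof.
move=> Ir Iid Iab.
have killI Y W : Y \in I -> W \in redpart ->
    lfun_tr (Q \o (br Y \o br W))%VF = 0.
  move=> YI Wr; have DY : D Y = 0 by rewrite redpart_ker// (subvP Ir).
  have DW := redpart_ker Wr.
  (* The operator has image in I and vanishes on I. *)
  have -> : (Q \o (br Y \o br W))%VF = (oproj ip I \o (Q \o (br Y \o br W)))%VF.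
    apply/lfunP => v; rewrite !comp_lfunE oproj_id// -(br_coproj DY) -(br_coproj DW).
    rewrite (br_anti brL) memvN; apply: Iid => //.
    by apply: br_redpart => //; apply: coproj_redpart.
  rewrite lfun_trC (_ : (_ \o oproj ip I)%VF = 0) ?lfun_tr0//.
  apply/lfunP => v; rewrite !comp_lfunE zero_lfunE.
  by rewrite Iab ?lfun0// Iid// memv_oproj.
have brI X Y : X \in redpart -> Y \in I -> br X Y \in redcen.
  move=> Xr YI; have DX := redpart_ker Xr.
  set Z := br X Y; have ZI : Z \in I by exact: Iid.
  have Zr := subvP Ir _ ZI; have DZ := redpart_ker Zr.
  apply/memv_redcen; split=> // W Wr.
  suff QZ : (Q \o br Z)%VF = 0.
    have /lfunP/(_ W) := QZ; rewrite comp_lfunE.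
    by rewrite -(br_coproj DZ) coproj_redpart_id// zero_lfunE.
  apply: (@lfun_tr_eq0 _ _ ip).
  have -> : adj (Q \o br Z)%VF = (Q \o adj (br Z))%VF.
    apply/lfunP => v; rewrite adjoint_comp !comp_lfunE.
    by rewrite (adjoint_selfadj (coproj_selfadj _ _)) (adjoint_coproj DZ).
  have DY : D Y = 0 by rewrite redpart_ker// (subvP Ir).
  have := killI _ _ YI (adjoint_redpart Z Xr).
  rewrite (br_adjoint DZ) comp_lfunDr comp_lfunNr comp_lfunDr comp_lfunNr lfun_trB.
  have -> : lfun_tr (Q \o (br Y \o (adj (br Z) \o br X)))%VF =
      lfun_tr (Q \o (br X \o (br Y \o adj (br Z))))%VF.
    rewrite !comp_lfunA lfun_trC !comp_lfunA; congr lfun_tr.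
    by apply/lfunP => v; rewrite !comp_lfunE !(br_coproj DX).
  rewrite -lfun_trB -comp_lfunNr -comp_lfunDr.
  have -> : ((br X \o (br Y \o adj (br Z))) - (br Y \o (br X \o adj (br Z))))%VF =
      (br Z \o adj (br Z))%VF.
    by apply/lfunP => v; rewrite !lfunE_op (br_jacobi brL).
  move=> T0; rewrite -T0; congr lfun_tr; apply/lfunP => v.
  by rewrite !comp_lfunE (br_coproj DZ) (coproj_redpart_id (coproj_redpart _)).
apply/subvP => Y YI; have Yr := subvP Ir _ YI.
apply/memv_redcen; split=> // W Wr.
rewrite (br_anti brL) redcen_br_eq0 ?oppr0//; exact: brI.
Qed.

(** By induction on the derived length the brackets in I are central, hence zero
   by [redcen_br_eq0]: I is abelian. *)
Lemma solvable_ideal_central I : (I <= redpart)%VS ->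
  (forall X Y, X \in redpart -> Y \in I -> br X Y \in I) ->
  solvable_sub br I -> (I <= redcen)%VS.
Proof.
move=> + + [k]; elim: k I => [|k IH] I Ir Iid; first by move=> /= ->; exact: sub0v.
rewrite iterSr => Ik.
have brI X Y : X \in I -> Y \in I -> br X Y \in I.
  by move=> XI YI; apply: Iid => //; apply: subvP Ir _ XI.
have IIc : (brv br I I <= redcen)%VS.
  apply: (IH _ _ _ Ik) => [|X Y Xr].
    by apply: brv_subP => X Y XI YI; apply: (subvP Ir); apply: brI.
  suff /subvP H : (brv br I I <= br X @^-1: brv br I I)%VS.
    by move=> /H; rewrite -memv_preim.
  apply: brv_subP => W Z WI ZI; rewrite -memv_preim.
  have -> : br X (br W Z) = br (br X W) Z + br W (br X Z).
    by rewrite (br_jacobi brL) subrK.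
  by apply: memvD; apply: mem_brv => //; apply: Iid.
apply: abelian_ideal_central => // X Y XI YI.
apply: redcen_br_eq0; try exact: (subvP Ir).
by apply: (subvP IIc); apply: mem_brv.
Qed.

Definition levi : {vspace V} := (redpart :&: orthov ip redcen)%VS.

Lemma memv_levi X :
  X \in levi <-> X \in redpart /\ forall A, A \in redcen -> ip X A = 0.
Proof.
rewrite memv_cap; split=> [/andP[-> /mem_orthovP]//|[-> H] /=].
exact/mem_orthovP.
Qed.

Lemma br_levi X Y : X \in redpart -> Y \in redpart -> br X Y \in levi.
Proof.
move=> Xr Yr; apply/memv_levi; split; first exact: br_redpart (redpart_ker Xr) _ Yr.
by move=> A Ac; apply: br_redcen_orth.
Qed.

Lemma redpart_split X : X \in redpart ->
  oproj ip redcen X \in redcen /\ coproj ip redcen X \in levi.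
Proof.
move=> Xr; have Cc : oproj ip redcen X \in redcen by exact: memv_oproj.
split=> //; apply/memv_levi; split; last by move=> A; exact: ip_coproj.
by have [Cr _] := (memv_redcen _).1 Cc; rewrite coprojE memvB.
Qed.

Lemma levi_semisimple : semisimple br levi.
Proof.
move=> I [Il Iid] Isol; apply/eqP; rewrite -subv0; apply/subvP => X XI.
have Ir : (I <= redpart)%VS by apply: subv_trans Il (capvSl _ _).
have Ic : (I <= redcen)%VS.
  apply: solvable_ideal_central => // Y Z Yr ZI.
  have [Ac Al] := redpart_split Yr.
  rewrite -(oproj_coproj ip redcen Y) lfunD add_lfunE.
  have [_ ->] := (memv_redcen _).1 Ac; last exact: (subvP Ir).
  by rewrite add0r; apply: Iid.
rewrite memv0; apply/eqP; apply: (@ip_eq0 _ _ ip).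
have [_ H] := (memv_levi _).1 (subvP Il _ XI); apply: H; exact: (subvP Ic).
Qed.

Lemma redcen_nrad_ideal : ideal_in br fullv (redcen + nn)%VS.
Proof.
split; first exact: subvf.
move=> X _ _ /memv_addP[A Ac [N Nn ->]]; apply: (subvP (addvSr _ _)).
have [Ar AW] := (memv_redcen _).1 Ac.
rewrite lfunD memvD//; last exact: br_nrad.
rewrite -(oproj_coproj ip nn X) lfunD add_lfunE.
rewrite (br_anti brL (Q X)) AW ?coproj_redpart// oppr0 addr0 (br_anti brL) memvN.
by rewrite br_nrad// memv_oproj.
Qed.

Lemma redcen_nrad_solvable : solvable_sub br (redcen + nn)%VS.
Proof.
have [k nk] := nilpotent_solvable (fun X Y _ => @br_nrad X Y)
  (nrad_nilpotent Dsym Dder Dge0).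
exists k.+1; apply/eqP; rewrite -subv0 -nk iterSr; apply: derivedS.
apply: brv_subP => _ _ /memv_addP[A Ac [N Nn ->]] /memv_addP[B Bc [M Mn ->]].
have [_ AW] := (memv_redcen _).1 Ac; have [Br _] := (memv_redcen _).1 Bc.
rewrite lfunD memvD//; last exact: br_nrad.
rewrite [br (A + N)]lfunD add_lfunE AW// add0r (br_anti brL) memvN.
exact: br_nrad.
Qed.

(** Q is a homomorphism onto redpart, with kernel the ideal nrad. *)
Lemma coproj_br X Y : Q (br X Y) = br (Q X) (Q Y).
Proof.
have -> : br X Y = br (P X) Y + br (Q X) Y.
  by rewrite -add_lfunE -lfunD oproj_coproj.
have PXY : Q (br (P X) Y) = 0.
  by rewrite (br_anti brL) lfunN coproj_nrad ?oppr0 ?br_nrad ?memv_oproj//.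
rewrite lfunD PXY.
by rewrite -(br_coproj (redpart_ker (coproj_redpart X))) add0r.
Qed.

Lemma solvable_image J k :
  (iter k (fun U => brv br U U) (Q @: J) <=
   Q @: iter k (fun U => brv br U U) J)%VS.
Proof.
elim: k => [|k IH] /=; first exact: subvv.
apply: brv_subP => _ _ /(subvP IH)/memv_imgP[X XJ ->] /(subvP IH)/memv_imgP[Y YJ ->].
by rewrite -coproj_br memv_img// mem_brv.
Qed.

Lemma solvable_ideal_sub J : ideal_in br fullv J -> solvable_sub br J ->
  (J <= redcen + nn)%VS.
Proof.
move=> [_ Jid] [k Jk].
have QJ : (Q @: J <= redcen)%VS.
  apply: solvable_ideal_central.
  - by apply/subvP => _ /memv_imgP[X _ ->]; exact: coproj_redpart.
  - move=> X _ Xr /memv_imgP[Y YJ ->].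
    by rewrite br_coproj ?redpart_ker// memv_img// Jid ?memvf.
  - exists k; apply/eqP; rewrite -subv0.
    by apply: subv_trans (solvable_image _ _) _; rewrite Jk limg0.
apply/subvP => X XJ; rewrite -(oproj_coproj ip nn X) addrC memv_add ?memv_oproj//.
by apply: (subvP QJ); rewrite memv_img.
Qed.

Lemma radical_redcen_nrad : is_radical br (redcen + nn)%VS.
Proof.
split; [exact: redcen_nrad_ideal|exact: redcen_nrad_solvable|].
exact: solvable_ideal_sub.
Qed.

(** An element X of J is A + N with A in redcen and N in nrad.  As ad X is
   nilpotent, so is br A ([graded_nilpotent]); and br A is normal, since its
   commutator with its adjoint is br ((br A)^* A), where (br A)^* A lies in redpart
   and is orthogonal to it.  So A is central, and lies in nrad. *)
Lemma nilpotent_ideal_sub J : ideal_in br fullv J -> nilpotent_sub br J ->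
  (J <= nn)%VS.
Proof.
move=> Jid Jnil; have [_ JidP] := Jid.
have Jsub X Y : X \in J -> Y \in J -> br X Y \in J.
  by move=> _; apply: JidP; rewrite memvf.
have Jsol := nilpotent_solvable Jsub Jnil.
apply/subvP => X XJ.
have /memv_addP[A Ac [N Nn XE]] := subvP (solvable_ideal_sub Jid Jsol) _ XJ.
have [Ar AW] := (memv_redcen _).1 Ac; have DA := redpart_ker Ar.
have [k brAk] : exists k, forall v, iter k (br A) v = 0.
  have /memv_addP[N1 N1D [N2]] := Nn; rewrite memv_ker => /eqP N2z NE.
  apply: (graded_nilpotent Dsym Dder Dge0 DA N1D).
  have -> : br (A + N1) = br X by rewrite XE NE !linearD /= N2z addr0.
  have [k Jk] := Jnil; exists k.+1 => v; apply/eqP; rewrite -memv0 -Jk {Jk}.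
  elim: k => [|k IH]; last by rewrite iterS /= mem_brv.
  by rewrite /= (br_anti brL) memvN JidP ?memvf.
have A0 : adj (br A) A = 0.
  have Cr : adj (br A) A \in redpart by exact: adjoint_redpart.
  by apply: (@ip_eq0 _ _ ip); rewrite -adjointPr AW// ip0r.
have brA : br A = 0.
  apply: (normal_nilpotent (ip := ip) _ brAk).
  have := br_adjoint DA A; rewrite A0 linear0 => /esym/eqP.
  by rewrite subr_eq0 => /eqP ->.
have An : A \in nn by apply: (subvP (addvSr _ _)); rewrite memv_ker brA.
by rewrite XE memvD.
Qed.

Lemma nilradical_nrad : is_nilradical br nn.
Proof.
split; [|exact: (nrad_nilpotent Dsym Dder Dge0)|].
  by split=> [|X Y _]; [exact: subvf|exact: br_nrad].
exact: nilpotent_ideal_sub.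
Qed.

Lemma sum_levi_redcen_nrad : (levi + redcen + nn)%VS = fullv.
Proof.
apply/eqP; rewrite eqEsubv subvf /=; apply/subvP => X _.
have [Ac Ml] := redpart_split (coproj_redpart X).
rewrite -(oproj_coproj ip nn X) addrC memv_add ?memv_oproj//.
by rewrite -(oproj_coproj ip redcen (Q X)) addrC memv_add.
Qed.

Lemma levi_redcen_orth X A : X \in levi -> A \in redcen -> ip X A = 0.
Proof. by move=> /memv_levi[_]; apply. Qed.

Lemma levi_nrad_orth X N : X \in levi -> N \in nn -> ip X N = 0.
Proof. by move=> /memv_levi[/memv_redpart + _] => /[apply]. Qed.

Lemma redcen_nrad_orth A N : A \in redcen -> N \in nn -> ip A N = 0.
Proof. by move=> /memv_redcen[/memv_redpart + _] => /[apply]. Qed.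

Lemma orth_cap_eq0 U I : (forall X Y, X \in U -> Y \in I -> ip X Y = 0) ->
  (U :&: I = 0)%VS.
Proof.
move=> UI; apply/eqP; rewrite -subv0; apply/subvP => X /memv_capP[XU XI].
by rewrite memv0; apply/eqP/(@ip_eq0 _ _ ip)/UI.
Qed.

Lemma levi_rad_orth X Y : X \in levi -> Y \in (redcen + nn)%VS -> ip X Y = 0.
Proof.
move=> Xl /memv_addP[A Ac [N Nn ->]].
by rewrite ipDr levi_redcen_orth// levi_nrad_orth// addr0.
Qed.

Lemma levi_redcen_cap : (levi :&: redcen = 0)%VS.
Proof. exact: orth_cap_eq0 levi_redcen_orth. Qed.

Lemma levi_redcen_nrad_cap : ((levi + redcen) :&: nn = 0)%VS.
Proof.
apply: orth_cap_eq0 => _ N /memv_addP[M Ml [A Ac ->]] Nn.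
by rewrite ipDl levi_nrad_orth// redcen_nrad_orth// addr0.
Qed.

Lemma levi_factor_levi : levi_factor br levi.
Proof.
split; [|exact: levi_semisimple|].
  move=> X Y /memv_levi[Xr _] /memv_levi[Yr _]; exact: br_levi.
exists (redcen + nn)%VS; first exact: radical_redcen_nrad.
split; first by rewrite addvA sum_levi_redcen_nrad.
exact: orth_cap_eq0 levi_rad_orth.
Qed.

(** The vector representing, up to sign, the linear form X |-> tr (br X) on
   redpart, as an analogue of the mean curvature vector. *)
Definition trace_vec : V :=
  \sum_(i < \dim {:V}) adj (br (Q (onb ip)`_i)) (Q (onb ip)`_i).

(** As the adjoint of br X is a derivation for X in redpart, br trace_vec is the
   sum of the commutators of the operators (br X)^* and br X. *)
Lemma tr_br_trace_vec (A : 'End(V)) : lfun_tr (A \o br trace_vec)%VF =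
  form_tr ip (fun X _ => lfun_tr (A \o (adj (br (Q X)) \o br (Q X)))%VF -
    lfun_tr (A \o (br (Q X) \o adj (br (Q X))))%VF).
Proof.
pose F Z := lfun_tr (A \o br Z)%VF.
have FD Y Z : F (Y + Z) = F Y + F Z.
  by rewrite /F linearD /= comp_lfunDr lfun_trD.
have F0 : F 0 = 0.
  by apply: (addrI (F 0)); rewrite -FD !addr0.
rewrite -/(F _) /trace_vec (big_morph F FD F0); apply: eq_bigr => i _.
rewrite /F (br_adjoint (redpart_ker (coproj_redpart _))) comp_lfunDr comp_lfunNr.
exact: lfun_trB.
Qed.

(** The square norm is minus the trace of br trace_vec on redpart, which is a sum
   of traces of commutators by [tr_br_trace_vec]. *)
Lemma trace_vec_eq0 : trace_vec = 0.
Proof.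
have mr : trace_vec \in redpart.
  by apply: memv_suml => i _; apply: adjoint_redpart; apply: coproj_redpart.
apply: (@ip_eq0 _ _ ip).
have -> : ip trace_vec trace_vec = - lfun_tr (Q \o br trace_vec)%VF.
  rewrite {1}/trace_vec ip_suml (lfun_trE ip) -form_trN; apply: eq_bigr => i _.
  rewrite -adjointPr (br_anti brL) ipNr comp_lfunE br_coproj ?redpart_ker//.
  rewrite -coproj_selfadj (coproj_redpart_id (coproj_redpart _)).
  by rewrite (ipC ip (Q _)) -coproj_selfadj.
rewrite tr_br_trace_vec form_tr0 ?oppr0// => X.
have DX := redpart_ker (coproj_redpart X).
apply/eqP; rewrite subr_eq0; apply/eqP.
have -> : (Q \o (adj (br (Q X)) \o br (Q X)))%VF =
    (adj (br (Q X)) \o (br (Q X) \o Q))%VF.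
  by apply/lfunP => v; rewrite !comp_lfunE (br_coproj DX) (adjoint_coproj DX).
rewrite lfun_trC; congr lfun_tr; apply/lfunP => v.
by rewrite !comp_lfunE (br_coproj DX).
Qed.

End Reductive.

(** * Restriction to the nilradical *)

Lemma vsvalB (K : fieldType) (V : vectType K) (U : {vspace V}) (X Y : subvs_of U) :
  vsval (X - Y) = vsval X - vsval Y.
Proof. by []. Qed.

Lemma vsvalZ (K : fieldType) (V : vectType K) (U : {vspace V}) c (X : subvs_of U) :
  vsval (c *: X) = c *: vsval X.
Proof. by []. Qed.

Section RestrictionToNilradical.
Variables (R : realType) (g V : vectType R).
Variables (ad : 'Hom(g, 'End(g))) (theta : 'End(g)).
Variable ip : {dot V for (@idfun R)}.
Hypotheses (adL : lie_bracket ad) (thetaC : cartan_involution ad theta).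
Variables (mu : 'Hom(V, 'End(V))) (phi : 'Hom(V, g)).
Local Notation x := ((mu, phi) : pairs g V).
Hypotheses (xL : in_Ln ad x) (Dx : act ad (Du ad theta ip x) x = 0).

Local Notation dotg := (dot_g ad theta).
Local Notation D := (Du ad theta ip x).1.
Local Notation u := (Du ad theta ip x).2.
Local Notation M := (moment ad theta ip x).
Local Notation nn := (nrad mu D).
Local Notation P := (oproj ip nn).
Local Notation Q := (coproj ip nn).
Local Notation adj := (adjoint ip).

Let muL : lie_bracket mu. Proof. by case: xL. Qed.
Let phiM X Y : phi (mu X Y) = ad (phi X) (phi Y). Proof. by case: xL. Qed.
Let xV : in_Vn x. Proof. exact: in_Ln_Vn xL. Qed.
Let Dsym : selfadj ip D. Proof. exact: Du_selfadj. Qed.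
Let Dder X Y : D (mu X Y) = mu (D X) Y + mu X (D Y).
Proof. exact: der_bracket Dx. Qed.
Let Dge0 X l : D X = l *: X -> X != 0 -> 0 <= l.
Proof. exact: Du_eigen_ge0. Qed.
Let Kder X : D X = 0 -> forall Y Z, adj (mu X) (mu Y Z) =
  mu (adj (mu X) Y) Z + mu Y (adj (mu X) Z).
Proof. by move=> DX; exact: (ker_adjoint_der adL thetaC xL Dx DX). Qed.

Let DQ X : D (Q X) = 0.
Proof. exact: (redpart_ker Dsym (coproj_redpart _ _ _ _)). Qed.

Lemma hom_trace_vec :
  \sum_(i < \dim {:V})
    ad (- theta (phi (Q (onb ip)`_i))) (phi (Q (onb ip)`_i)) = 0.
Proof.
transitivity (phi (trace_vec ip mu D)); last first.
  by rewrite (trace_vec_eq0 muL Dsym Dder Dge0 Kder) lfun0.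
rewrite linear_sum; apply: eq_bigr => i _.
exact: (ker_adjoint_hom adL thetaC xL Dx (DQ _)).
Qed.

Local Notation sub := (subvs_of nn).
Local Notation ip' := (subdot ip nn : {dot sub for (@idfun R)}).
Local Notation y := (restr nn x).
Local Notation incl := (linfun vsval : 'Hom(sub, V)).
Local Notation prj := ((linfun (vsproj nn) : 'Hom(V, sub)) \o P)%VF.

Let nrad_sub : subalgebra mu nn.
Proof. by move=> X Y _ Yn; exact: (br_nrad muL Dsym Dder Dge0). Qed.

Lemma inclE X : incl X = vsval X. Proof. by rewrite lfunE. Qed.

Lemma vsval_prj X : vsval (prj X) = P X.
Proof. by rewrite comp_lfunE lfunE /= vsprojK// memv_oproj. Qed.

Lemma restr_br X Y : vsval (y.1 X Y) = mu (vsval X) (vsval Y).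
Proof. exact: restr_bracketE nrad_sub. Qed.

Lemma restr_hom X : y.2 X = phi (vsval X).
Proof. exact: restr_homE. Qed.

Lemma restr_in_Ln : in_Ln ad y.
Proof.
split; last by move=> X Y; rewrite !restr_hom restr_br phiM.
split=> [X|X Y Z]; apply: subvs_inj; first by rewrite restr_br (proj1 muL).
by rewrite !linearD /= !restr_br (proj2 muL).
Qed.

(** An operator A on the nilradical acts on the whole space as A', through the
   orthogonal projection; products with A and with A' are compared. *)
Section Extend.
Variables (A : 'End(sub)) (v : g).
Local Notation A' := (incl \o (A \o prj))%VF.

Lemma extE X : A' X = P (A' X).
Proof. by rewrite oproj_id// !comp_lfunE inclE subvsP. Qed.

Lemma ext_P X : A' (P X) = A' X.
Proof. by rewrite !comp_lfunE oprojK. Qed.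

Lemma ext_Q X : A' (Q X) = 0.
Proof. by rewrite coprojE lfunD lfunN ext_P subrr. Qed.

Lemma ext_incl X : A' (vsval X) = vsval (A X).
Proof.
rewrite comp_lfunE inclE comp_lfunE; congr (vsval (A _)); apply: subvs_inj.
by rewrite vsval_prj oproj_id// subvsP.
Qed.

Lemma gcdot_restr :
  dot_gc ad theta ip' ((prj \o M.1 \o incl)%VF, M.2) (A, v) =
  dot_gc ad theta ip M (A', v).
Proof.
rewrite !gcdotE /=; congr (_ + _).
pose b X Y := ip (M.1 X) (A' Y).
have bb : bilin b by apply: bilin_dot => c X Y; rewrite lfunL.
transitivity (form_tr ip b); last first.
  rewrite (lfun_trE ip).
  have -> : form_tr ip b = form_tr ip (fun X Y => ip (M.1 (adj A' X)) Y).
    rewrite (@form_tr_shift _ _ ip (fun X Y => ip (M.1 X) Y)) ?adjointK//.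
    by split=> c X Y Z; rewrite ?lfunL (ip_linl, ip_linr).
  by apply: eq_form_tr => X; rewrite [in RHS]comp_lfunE.
rewrite (form_tr_split ip nn bb) [X in _ = _ + X]form_tr0 ?addr0; last first.
  by move=> X; rewrite /b ext_Q ip0r.
rewrite -(form_tr_oproj ip nn bb) (lfun_trE ip').
transitivity (form_tr ip' (fun X Y => ip' ((prj \o M.1 \o incl)%VF X) (A Y))).
  rewrite [RHS](@form_tr_shiftr _ _ ip' (fun X Y =>
      ip' ((prj \o M.1 \o incl)%VF X) Y)).
    by apply: eq_form_tr => X; rewrite [in LHS]comp_lfunE.
  by split=> c X Y Z; rewrite ?lfunL (ip_linl, ip_linr).
apply: eq_form_tr => X; rewrite subdotE /b ext_incl 2!comp_lfunE vsval_prj.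
by rewrite inclE oproj_selfadj oproj_id// subvsP.
Qed.

Let C X := mu (Q X).

Let G X X' Y Y' := ip (act_bracket A' mu X Y) (mu X' Y').
Let H X X' := dotg (ad v (phi X) - phi (A' X)) (phi X').

Let G1 Y Y' : bilin (fun X X' => G X X' Y Y').
Proof. by apply: bilin_dot => c X Z; rewrite lfun2_linl. Qed.

Let G2 X X' : bilin (fun Y Y' => G X X' Y Y').
Proof. by apply: bilin_dot => c Y Z; rewrite lfunL. Qed.

Let Hb : bilin H.
Proof.
split=> c X Y Z; last by rewrite /H lfunL (dotg_linr thetaC).
by rewrite /H !lfunL scale_add_sub dotg_linl.
Qed.

Let mu_anti X Y : mu X Y = - mu Y X. Proof. exact: br_anti. Qed.

Let G_sym X Y : G X X Y Y = G Y Y X X.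
Proof.
have aV : in_Vn (act ad (A', v) x) by exact: act_in_Vn.
by rewrite /G mu_anti (in_Vn_anti X Y aV) ipNl ipNr opprK.
Qed.

(** The part of the sum along redpart is - <v, phi trace_vec>. *)
Lemma form_H : form_tr ip H = form_tr ip (fun X X' => H (P X) (P X')).
Proof.
rewrite (form_tr_split ip nn Hb) -[RHS]addr0; congr (_ + _).
transitivity (form_tr ip (fun X X' =>
    - dotg v (ad (- theta (phi (Q X))) (phi (Q X'))))).
  apply: eq_form_tr => X; rewrite /H ext_Q lfun0 subr0.
  by rewrite (br_anti adL) (dotgNl thetaC) (dotg_ad adL thetaC).
rewrite form_trN; apply/eqP; rewrite oppr_eq0; apply/eqP.
pose F w := dotg v w.
have FD w z : F (w + z) = F w + F z by exact: (dotgDr thetaC).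
have F0 : F 0 = 0 by rewrite /F (dotgC thetaC) (dotg0l thetaC).
by rewrite /form_tr -(big_morph F FD F0) hom_trace_vec.
Qed.

(** Here br (Q X) commutes with P, and A' is unchanged by composition with P on
   either side, so the projections can be dropped. *)
Let cross_tr X : form_tr ip (fun Y Y' => G (Q X) (Q X) (P Y) (P Y')) =
  lfun_tr (A' \o (C X \o adj (C X)))%VF - lfun_tr (A' \o (adj (C X) \o C X))%VF.
Proof.
have DX := DQ X.
have CP Y : C X (P Y) = P (C X Y).
  have PQ Z : P Z = Z - Q Z by rewrite coprojE subKr.
  by rewrite !PQ lfunD lfunN /C (br_coproj muL Dsym Dder Dge0 Kder DX Y).
transitivity (form_tr ip (fun Y Y' => ip (A' (C X Y)) (C X Y')) -
    form_tr ip (fun Y Y' => ip (C X (A' Y)) (C X Y'))).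
  rewrite -form_trB; apply: eq_form_tr => Y.
  rewrite /G act_bracketE ext_Q linear0 zero_lfunE subr0 ipBl -/(C X).
  rewrite CP !ext_P; congr (_ - _); first by rewrite -oproj_selfadj -extE.
  by rewrite -oproj_selfadj -CP -extE.
have bC (B : 'End(V)) : bilin (fun Y Y' => ip (B Y) (C X Y')).
  by apply: bilin_dot => c Y Z; rewrite lfunL.
congr (_ - _).
  rewrite (comp_lfunA A' (C X)) lfun_trC (lfun_trE ip); apply: eq_form_tr => Y.
  by rewrite !comp_lfunE -adjointPr.
rewrite lfun_trC (lfun_trE ip); apply: eq_form_tr => Y.
by rewrite !comp_lfunE -adjointPr.
Qed.

(** Of the four parts of the double sum, the one along redpart twice vanishes as
   redpart is a subalgebra; the two mixed ones are equal, and by [cross_tr] their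
   common value is a trace against br trace_vec = 0. *)
Lemma form_G : form_tr ip (fun X X' => form_tr ip (G X X')) =
  form_tr ip (fun X X' => form_tr ip (fun Y Y' => G (P X) (P X') (P Y) (P Y'))).
Proof.
have Gt : bilin (fun X X' => form_tr ip (G X X')).
  by apply: bilin_form_tr => Y; exact: G1.
pose T (S S' : 'End(V)) :=
  form_tr ip (fun X X' => form_tr ip (fun Y Y' => G (S X) (S X') (S' Y) (S' Y'))).
have split_in (S : 'End(V)) : form_tr ip (fun X X' => form_tr ip (G (S X) (S X'))) =
    T S P + T S Q.
  rewrite /T -form_trD; apply: eq_form_tr => X.
  exact: (form_tr_split ip nn (G2 _ _)).
have TQP : T Q P = 0.
  rewrite /T; transitivity (- lfun_tr (A' \o mu (trace_vec ip mu D))%VF).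
    rewrite (tr_br_trace_vec Dsym Kder) -form_trN.
    by apply: eq_form_tr => X; rewrite cross_tr opprB.
  rewrite (trace_vec_eq0 muL Dsym Dder Dge0 Kder) linear0 comp_lfun0r.
  by rewrite lfun_tr0 oppr0.
have TPQ : T P Q = 0.
  rewrite -TQP /T exchange_form_tr; apply: eq_form_tr => X.
  by apply: eq_form_tr => Y; rewrite G_sym.
have TQQ : T Q Q = 0.
  apply: form_tr0 => X; apply: form_tr0 => Y.
  rewrite /G act_bracketE !ext_Q linear0 zero_lfunE lfun0 !subr0.
  have XYr := br_redpart Dsym Dder Kder (DQ X) (coproj_redpart ip mu D Y).
  rewrite -(coproj_redpart_id XYr).
  by rewrite ext_Q ip0l.
rewrite (form_tr_split ip nn Gt) (split_in P) (split_in Q) TPQ TQP TQQ.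
by rewrite !addr0.
Qed.

Lemma pairdot_restr : pairdot ad theta ip' (act ad (A, v) y) y =
  pairdot ad theta ip (act ad (A', v) x) x.
Proof.
have E1 : form_tr ip' (fun X X' => form_tr ip' (fun Y Y' =>
      ip' ((act ad (A, v) y).1 X Y) (y.1 X' Y'))) =
    form_tr ip (fun X X' => form_tr ip (G X X')).
  rewrite form_G.
  transitivity (form_tr ip' (fun X X' : sub => form_tr ip' (fun Y Y' : sub =>
      G (vsval X) (vsval X') (vsval Y) (vsval Y')))).
    apply: eq_form_tr => X; apply: eq_form_tr => Y.
    rewrite subdotE restr_br /G; congr (ip _ _).
    by rewrite !act_bracketE !vsvalB -(restr_br X Y) !ext_incl !restr_br.
  rewrite (@form_tr_oproj _ _ ip nn (fun X X' => form_tr ip' (fun Y Y' : sub =>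
     G X X' (vsval Y) (vsval Y')))); last first.
    apply: bilin_form_tr => Y; exact: G1.
  by apply: eq_form_tr => X; rewrite (form_tr_oproj ip nn (G2 _ _)).
have E2 : form_tr ip' (fun X X' => dotg ((act ad (A, v) y).2 X) (y.2 X')) =
    form_tr ip H.
  rewrite form_H -(form_tr_oproj ip nn Hb); apply: eq_form_tr => X.
  by rewrite act_homE !restr_hom /H ext_incl.
rewrite /pairdot E1 E2; congr (_ + _).
by apply: eq_form_tr => X; rewrite act_homE.
Qed.

End Extend.

(** The compression of the moment satisfies the defining property of the moment
   of the restriction, by [gcdot_restr] and [pairdot_restr]. *)
Lemma moment_restr : moment ad theta ip' y = ((prj \o M.1 \o incl)%VF, M.2).
Proof.
apply: (moment_uniq thetaC); first exact: in_Ln_Vn restr_in_Ln.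
by case=> A v; rewrite gcdot_restr pairdot_restr momentP.
Qed.

Lemma Du_restr_snd : (Du ad theta ip' y).2 = u.
Proof. by rewrite /Du moment_restr /= !scaler0. Qed.

Let D' : gc g sub := ((prj \o D \o incl)%VF, u).

Let D'E X : vsval (D'.1 X) = D (vsval X).
Proof.
rewrite 2!comp_lfunE vsval_prj inclE oproj_id//.
by apply: (subvP (addvSl _ _)); rewrite memv_img// memvf.
Qed.

Let act_D' : act ad D' y = 0.
Proof.
congr (_, _); apply/lfunP => X; last first.
  rewrite zero_lfunE act_homE !restr_hom D'E.
  by rewrite -(der_hom _ Dx) subrr.
apply/lfunP => Y; rewrite !zero_lfunE act_bracketE; apply: subvs_inj.
rewrite !vsvalB D'E !restr_br !D'E Dder linear0.
by rewrite addrAC addrK subrr.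
Qed.

Let D_nn X : D X \in nn.
Proof. by apply: (subvP (addvSl _ _)); rewrite memv_img// memvf. Qed.

Let momentE X : M.1 X = D X - kappa ad theta ip x *: X.
Proof. by rewrite /Du /= !lfunE_op addrK. Qed.

Let moment_D' : moment ad theta ip' y =
  D' - kappa ad theta ip x *: ((\1%VF, 0) : gc g sub).
Proof.
rewrite moment_restr; congr (_, _); last by rewrite /= !scaler0 addr0 subr0.
apply/lfunP => X; rewrite add_lfunE opp_lfunE scale_lfunE id_lfunE.
apply: subvs_inj; rewrite vsvalB vsvalZ D'E 2!comp_lfunE vsval_prj inclE.
by rewrite momentE oproj_id// memvB ?D_nn ?memvZ ?subvsP.
Qed.

(** Since D' annihilates the restriction y, <M y, D'> = 0; with M y = D' - k id
   this gives |M y|^2 = - k <M y, id> = k |y|^2. *)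
Lemma Du_restr : y != 0 -> Du ad theta ip' y = D'.
Proof.
move=> y0; have yV : in_Vn y := in_Ln_Vn restr_in_Ln.
have pyy : pairdot ad theta ip' y y != 0.
  by apply/eqP => /(pairdot_eq0 thetaC)/eqP; rewrite (negPf y0).
suff kE : kappa ad theta ip' y = kappa ad theta ip x.
  by rewrite /Du kE moment_D' subrK.
have E a : dot_gc ad theta ip' (moment ad theta ip' y) a =
    pairdot ad theta ip' (act ad a y) y by rewrite momentP.
rewrite [LHS]/kappa dot_pairsE// {2}moment_D' (gcdotC ip' thetaC) gcdotDl// gcdotNl//.
rewrite gcdotZl// !(gcdotC ip' thetaC _ (moment _ _ _ _)) !E act_D' act_id.
have pb := pairdot_bilin ip' thetaC.
by rewrite (bilin0l _ pb) sub0r pdotNl// mulrN opprK mulfK.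
Qed.

Lemma critical_restr : y != 0 -> critical ad theta ip' y /\
  forall X : sub, vsval ((Du ad theta ip' y).1 X) = D (vsval X).
Proof.
move=> y0; split; last by move=> X; rewrite Du_restr// D'E.
by apply/(criticalP ip' adL thetaC restr_in_Ln y0); rewrite Du_restr.
Qed.

Lemma structure_of_critical : exists m a n : {vspace V},
  [/\ (m + a + n = fullv)%VS, directv (m + a + n),
      {in m & a, forall X Y, ip X Y = 0},
      {in m & n, forall X Y, ip X Y = 0} &
      {in a & n, forall X Y, ip X Y = 0}] /\
  [/\ levi_factor mu m, is_radical mu (a + n)%VS & is_nilradical mu n] /\
  (Du ad theta (subdot ip n) (restr n x)).2 = u /\
  (restr n x != 0 -> critical ad theta (subdot ip n) (restr n x) /\
     forall X : subvs_of n,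
       vsval ((Du ad theta (subdot ip n) (restr n x)).1 X) = D (vsval X)).
Proof.
exists (levi ip mu D), (redcen ip mu D), nn; split; last split.
- split.
  + exact: sum_levi_redcen_nrad.
  + by apply: directv3; [exact: levi_redcen_cap|exact: levi_redcen_nrad_cap].
  + by move=> X Y; exact: levi_redcen_orth.
  + by move=> X Y; exact: levi_nrad_orth.
  + by move=> X Y; exact: redcen_nrad_orth.
- split.
  + exact: (levi_factor_levi muL Dsym Dder Dge0 Kder).
  + exact: (radical_redcen_nrad muL Dsym Dder Dge0 Kder).
  + exact: (nilradical_nrad muL Dsym Dder Dge0 Kder).
- by split; [exact: Du_restr_snd|exact: critical_restr].
Qed.

End RestrictionToNilradical.

Theorem theorem4p2 (R : realType) (g : vectType R) (ad : 'Hom(g, 'End(g)))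
    (theta : 'End(g)) (n : nat) (ip : {dot 'rV[R]_n for (@idfun R)})
    (mu : 'Hom('rV[R]_n, 'End('rV[R]_n))) (phi : 'Hom('rV[R]_n, g)) :
  lie_bracket ad -> semisimple ad fullv -> cartan_involution ad theta ->
  critical ad theta ip (mu, phi) ->
  exists m a nn : {vspace 'rV[R]_n},
    [/\ (m + a + nn = fullv)%VS, directv (m + a + nn),
        {in m & a, forall X Y, ip X Y = 0},
        {in m & nn, forall X Y, ip X Y = 0} &
        {in a & nn, forall X Y, ip X Y = 0}] /\
    [/\ levi_factor mu m, is_radical mu (a + nn)%VS & is_nilradical mu nn] /\
    let nu_psi := restr nn (mu, phi) in
    let ip' : {dot (subvs_of nn) for (@idfun R)} := restr_dot ip in
    (Du ad theta ip' nu_psi).2 = (Du ad theta ip (mu, phi)).2 /\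
    (nu_psi != 0 ->
       critical ad theta ip' nu_psi /\
       forall X : subvs_of nn,
         vsval ((Du ad theta ip' nu_psi).1 X) =
         (Du ad theta ip (mu, phi)).1 (vsval X)).
Proof.
move=> adL _ thetaC crit; have [xL x0 _] := crit.
apply: (structure_of_critical adL thetaC xL).
exact/(criticalP ip adL thetaC xL x0).
Qed.
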